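(* Let $\mathbb{H}(d,\boldsymbol{\alpha})$ and $\mathbb{H}(d',\boldsymbol{\alpha}')$ be two corank $1$ Carnot groups with $\boldsymbol{\alpha}=(\alpha_1,\ldots,\alpha_n)$ and $\boldsymbol{\alpha}'=(\alpha_1',\ldots,\alpha_{n'}')$, and let $\{\bar\pi_j\}_{j=1}^{d+2n+d'+2n'}$ be the associated projections on the product space $\mathbb{H}(d,\boldsymbol{\alpha})\times\mathbb{H}(d',\boldsymbol{\alpha}')$. Put $N:=d+2n+d'+2n'+3$. Then $$\int_{\mathbb{H}(d,\boldsymbol{\alpha})\times\mathbb{H}(d',\boldsymbol{\alpha}')}\ \prod_{j=1}^{d+2n+d'+2n'}f_j(\bar\pi_j(x,t,x',t'))\,dx\,dt\,dx'\,dt'$$ $$\le \mathbf{C}(d,\boldsymbol{\alpha},d',\boldsymbol{\alpha}')\prod_{j=1}^d\|f_j\|_{N}\prod_{j=d+1}^{d+2n}\|f_j\|_{\frac{nN}{n+1}}\ \prod_{j=d+2n+1}^{d+2n+d'}\|f_j\|_{N}\prod_{j=d+2n+d'+1}^{d+2n+d'+2n'}\|f_j\|_{\frac{n'N}{n'+1}}$$ for all non-negative measurable functions $f_1,\ldots,f_{d+2n+d'+2n'}$ on $\mathbb{R}^{d+2n+d'+2n'+1}$, where $$\mathbf{C}(d,\boldsymbol{\alpha},d',\boldsymbol{\alpha}'):=\frac{\|\mathbf{R}\|_{\frac32\to3}^{\frac{6}{N}}}{\left(\prod_{j=1}^n\alpha_j\right)^{\frac{1}{nN}}\left(\prod_{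j=1}^{n'}\alpha_j'\right)^{\frac{1}{n'N}}}.$$
   Context: For $d\in\mathbb{N}=\{0,1,\ldots\}$, $n\in\{1,2,\ldots\}$ and $\boldsymbol{\alpha}=(\alpha_1,\ldots,\alpha_n)$ with $0<\alpha_1\le\cdots\le\alpha_n<+\infty$, the corank $1$ Carnot group $\mathbb{H}(d,\boldsymbol{\alpha})$ is $\mathbb{R}^{d+2n}\times\mathbb{R}$ (points $(x,t)$) with group law $$(x,t)\cdot(x',t')=\Big(x+x',\,t+t'+\tfrac12\sum_{j=1}^n\alpha_j(x_{d+2j-1}x'_{d+2j}-x_{d+2j}x'_{d+2j-1})\Big),$$ equipped with Lebesgue measure. With $\hat x_j$ denoting $x$ with its $j$-th coordinate deleted, its projections $\pi_1,\ldots,\pi_{d+2n}:\mathbb{R}^{d+2n+1}\to\mathbb{R}^{d+2n}$ are - $\pi_j(x,t)=(\hat x_j,t)$ for $1\le j\le d$; - $\pi_{d+2j-1}(x,t)=(\hat x_{d+2j-1},t+\tfrac{\alpha_j}{2}x_{d+2j-1}x_{d+2j})$ for $1\le j\le n$; - $\pi_{d+2j}(x,t)=(\hat x_{d+2j},t-\tfrac{\alpha_j}{2}x_{d+2j-1}x_{d+2j})$ for $1\le j\le n$. Write $\pi'_1,\ldots,\pi'_{d'+2n'}$ for the corresponding projections of $\mathbb{H}(d',\boldsymbol{\alpha}')$ (with $d'\in\mathbb{N}$, $n'\ge1$, $0<\alpha_1'\le\cdots\le\alpha'_{n'}<+\infty$). On the product, $\bar\pi_j(x,t,x',t')=(\pi_j(x,t),x',t')$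 for $1\le j\le d+2n$, and $\bar\pi_j(x,t,x',t')=(x,t,\pi'_{j-d-2n}(x',t'))$ for $d+2n+1\le j\le d+2n+d'+2n'$; both take values in $\mathbb{R}^{d+2n+d'+2n'+1}$. $\|f\|_p$ is the $L^p$ norm (possibly $+\infty$) with respect to Lebesgue measure; $0\cdot\infty=0$. $\|\mathbf{R}\|_{\frac32\to3}<+\infty$ is the operator norm from $L^{3/2}(\mathbb{R}^2)$ to $L^3(\mathbb{S}^1\times\mathbb{R})$ of the Radon transform $\mathbf{R}f(\sigma,s):=\int_{\{x\in\mathbb{R}^2:\langle x,\sigma\rangle=s\}}f(x)\,dx$ ($\sigma\in\mathbb{S}^1$, $s\in\mathbb{R}$, $dx$ the $1$-dimensional Lebesgue measure on the line), where $\mathbb{S}^1\subset\mathbb{R}^2$ is the unit circle and $\mathbb{S}^1\times\mathbb{R}$ carries arc-length measure times Lebesgue measure. *)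

(* Defs.v *)
From HB Require Import structures.
From mathcomp Require Import all_boot all_order all_algebra.
From mathcomp Require Import all_classical all_reals all_analysis.
From mathcomp Require Import measurable_realfun ring zify.

Set Implicit Arguments.
Unset Strict Implicit.
Unset Printing Implicit Defensive.
Import Order.TTheory GRing.Theory Num.Def Num.Theory.
Import numFieldNormedType.Exports.
Local Open Scope classical_set_scope.
Local Open Scope ring_scope.

(* For general sigma-finite factors, canonical inference on (m1 \x m2) finds
   only the instance for subprobabilities. *)
Lemma sigma_finite_product d1 d2 (T1 : measurableType d1)
    (T2 : measurableType d2) (R : realType)
    (m1 : {sigma_finite_measure set T1 -> \bar R})
    (m2 : {sigma_finite_measure set T2 -> \bar R}) :
  sigma_finite setT (m1 \x m2)%E.
Proof.
have /sigma_finiteP[F [TF ndF Foo]] := sigma_finiteT m1.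
have /sigma_finiteP[G [TG ndG Goo]] := sigma_finiteT m2.
exists (fun n => F n `*` G n).
  rewrite -setXTT TF TG predeqE => -[x y]; split.
    move=> [/= [n _ Fnx] [k _ Gky]]; exists (maxn n k) => //; split.
    - by move: x Fnx; exact/subsetPset/ndF/leq_maxl.
    - by move: y Gky; exact/subsetPset/ndG/leq_maxr.
  by move=> [n _ []/= ? ?]; split; exists n.
move=> k; have [? ?] := Foo k; have [? ?] := Goo k.
split; first exact: measurableX.
by rewrite product_measure1E// lte_mul_pinfty// ge0_fin_numE.
Qed.

Section lebesgue_tuple.
Context {R : realType}.
Local Notation mR := (measurableTypeR R).

Definition consp n (p : mR * n.-tuple mR) : n.+1.-tuple mR :=
  [tuple of p.1 :: p.2].

Lemma measurable_consp n : measurable_fun [set: mR * n.-tuple mR] (@consp n).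
Proof. exact: measurable_cons. Qed.

Definition unconsp n (x : n.+1.-tuple mR) : mR * n.-tuple mR :=
  (thead x, [tuple of behead x]).

Lemma unconspK n : cancel (@unconsp n) (@consp n).
Proof. by move=> x; rewrite /consp /= -tuple_eta. Qed.

Lemma conspK n : cancel (@consp n) (@unconsp n).
Proof. by case=> a x; congr pair; exact: val_inj. Qed.

Lemma measurable_unconsp n :
  measurable_fun [set: n.+1.-tuple mR] (@unconsp n).
Proof.
by apply: measurable_fun_pair; [exact: measurable_tnth|exact: measurable_behead].
Qed.

Section cons_measure.
Context n (mu : {sigma_finite_measure set (n.-tuple mR) -> \bar R}).

Definition cons_measure : set (n.+1.-tuple mR) -> \bar R :=
  pushforward (@lebesgue_measure R \x mu)%E (@consp n).

Let cons_measure0 : cons_measure set0 = 0%E.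
Proof. by rewrite /cons_measure /pushforward preimage_set0 measure0. Qed.

Let cons_measure_ge0 A : (0 <= cons_measure A)%E.
Proof. by rewrite /cons_measure /pushforward measure_ge0. Qed.

Let cons_measure_sigma_additive : semi_sigma_additive cons_measure.
Proof.
pose m := measure_function_pushforward__canonical__measure_function_Measure.
have := @measure_semi_sigma_additive _ _ _
  (m _ _ _ _ _ (@lebesgue_measure R \x mu)%E _ (@measurable_consp n)).
exact.
Qed.

HB.instance Definition _ := isMeasure.Build _ _ _ cons_measure
  cons_measure0 cons_measure_ge0 cons_measure_sigma_additive.

Let cons_measure_sigma_finite : sigma_finite setT cons_measure.
Proof.
have [F FT mF] := sigma_finite_product (@lebesgue_measure R) mu.
exists (fun k => @unconsp n @^-1` F k).
  by rewrite -preimage_bigcup -FT preimage_setT.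
move=> k; have [mFk Fkoo] := mF k; split.
  by rewrite -[X in measurable X]setTI; exact: measurable_unconsp.
rewrite /cons_measure /pushforward -comp_preimage.
suff -> : @unconsp n \o @consp n = id by rewrite preimage_id.
by apply/funext => p; rewrite /= conspK.
Qed.

HB.instance Definition _ := Measure_isSigmaFinite.Build _ _ _ cons_measure
  cons_measure_sigma_finite.

End cons_measure.


(* Lebesgue measure on the Borel sigma-algebra of R^n; borel_lebesgue_box
   characterizes it. *)
Fixpoint borel_lebesgue n : {sigma_finite_measure set (n.-tuple mR) -> \bar R} :=
  if n is n'.+1 then cons_measure (borel_lebesgue n')
  else @dirac _ (0.-tuple mR) [tuple] R.

Lemma borel_lebesgue_box n (A : 'I_n -> set mR) :
  (forall i, measurable (A i)) ->
  borel_lebesgue n [set x | forall i, A i (tnth x i)] =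
  (\prod_(i < n) lebesgue_measure (A i))%E.
Proof.
elim: n A => [|n IHn] A mA /=.
  rewrite big_ord0 diracE mem_set//=; by case.
rewrite big_ord_recl -IHn// -product_measure1E//; last first.
  rewrite (_ : mkset _ = \bigcap_(i in [set: 'I_n])
      (tnth (T := mR) ^~ i) @^-1` A (lift ord0 i)).
    apply: fin_bigcap_measurable => // i _; rewrite -[X in measurable X]setTI.
    exact: measurable_tnth.
  by apply/seteqP; split=> [x Ax i _|x Ax i]; [exact: (Ax i)|exact: (Ax i I)].
rewrite /cons_measure /pushforward; congr (_ _).
apply/seteqP; split=> -[a x] /= => [Ax|[Aa Ax] i].
  split=> [|i]; first by have := Ax ord0; rewrite tnth0.
  by have := Ax (lift ord0 i); rewrite tnthS.
by case: (unliftP ord0 i) => [j|] ->; rewrite ?tnthS ?tnth0.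
Qed.

End lebesgue_tuple.

Section carnot.
Context {R : realType}.

(* Coordinates are numbered from 0: x`_i is the (i+1)-st coordinate of x. Points
   (x, t) of H(d, alpha) are pairs in (d + 2 * n).-tuple R * R. *)
Definition carnot_mul d n (alpha : n.-tuple R)
    (p q : (d + 2 * n).-tuple R * R) : (d + 2 * n).-tuple R * R :=
  ([tuple tnth p.1 i + tnth q.1 i | i < d + 2 * n],
   p.2 + q.2 + 2^-1 * \sum_(j < n) alpha`_j *
     (p.1`_(d + 2 * j) * q.1`_(d + 2 * j).+1
      - p.1`_(d + 2 * j).+1 * q.1`_(d + 2 * j))).

Definition delete_coord (k : nat) (x : seq R) : seq R :=
  take k x ++ drop k.+1 x.

(* Last coordinate of pi_(k+1)(x, t). For k >= d, k = d + 2j or k = d + 2j + 1,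
   and the parity of k - d determines the sign. *)
Definition proj_height d n (alpha : n.-tuple R) (k : nat) (x : seq R) (t : R) :=
  if (k < d)%N then t else
  let j := (k - d)./2 in
  let c := alpha`_j / 2 * x`_(d + 2 * j) * x`_(d + 2 * j).+1 in
  if odd (k - d) then t - c else t + c.

Definition proj_seq d n (alpha : n.-tuple R) (k : nat) (x : seq R) (t : R) :=
  rcons (delete_coord k x) (proj_height d alpha k x t).

Lemma size_proj d n (alpha : n.-tuple R) (k : 'I_(d + 2 * n))
    (x : (d + 2 * n).-tuple R) (t : R) :
  size (proj_seq d alpha k x t) == (d + 2 * n)%N.
Proof.
rewrite size_rcons size_cat size_take size_drop size_tuple ltn_ord.
by rewrite -addnS subnSK// subnKC// ltnW.
Qed.

Definition proj d n (alpha : n.-tuple R) (k : 'I_(d + 2 * n))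
    (p : (d + 2 * n).-tuple R * R) : (d + 2 * n).-tuple R :=
  Tuple (size_proj alpha k p.1 p.2).

(* The fibres of the k-th projection are the cosets of the k-th coordinate
   line. *)
Lemma proj_carnot_mul d n (alpha : n.-tuple R) (k : 'I_(d + 2 * n))
    (p : (d + 2 * n).-tuple R * R) (s : R) :
  proj alpha k
    (carnot_mul alpha p ([tuple if i == k then s else 0 | i < d + 2 * n], 0))
  = proj alpha k p.
Proof.
set q := [tuple if i == k then s else 0 | i < d + 2 * n].
have qE i : q`_i = if i == k :> nat then s else 0.
  have [ilt|ige] := ltnP i (d + 2 * n).
    by rewrite (_ : i = Ordinal ilt)// -tnth_nth tnth_mktuple.
  rewrite nth_default ?size_tuple// gtn_eqF//.
  exact: leq_trans (ltn_ord k) ige.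
case: p => x t.
pose y := [tuple tnth x i + tnth q i | i < d + 2 * n].
have yE i : y`_i = x`_i + q`_i.
  have [ilt|ige] := ltnP i (d + 2 * n).
    by rewrite (_ : i = Ordinal ilt)// -!tnth_nth tnth_mktuple.
  by rewrite !nth_default ?size_tuple// addr0.
have -> : carnot_mul alpha (x, t) (q, 0) = (y, t + 0 + 2^-1 *
    \sum_(j < n) alpha`_j * (x`_(d + 2 * j) * q`_(d + 2 * j).+1
                            - x`_(d + 2 * j).+1 * q`_(d + 2 * j))) by [].
clearbody y q; apply: val_inj; rewrite /= /proj_seq; congr rcons.
  apply: (@eq_from_nth _ 0).
    by rewrite /delete_coord !size_cat !size_take !size_drop !size_tuple.
  move=> i _; rewrite /delete_coord !nth_cat !size_take !size_tuple ltn_ord.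
  case: ltnP => ik.
    by rewrite !nth_take// yE qE ltn_eqF// addr0.
  by rewrite !nth_drop yE qE gtn_eqF ?addr0// leq_addr.
rewrite /proj_height; case: ltnP => kd.
  rewrite big1 ?mulr0 ?addr0// => j _.
  rewrite !qE !gtn_eqF ?mulr0 ?subr0 ?mulr0//.
    exact: leq_trans kd (leq_addr _ _).
  by rewrite ltnS (leq_trans (ltnW kd))// leq_addr.
have kE : (k - d = odd (k - d) + 2 * (k - d)./2)%N.
  by have := odd_double_half (k - d); rewrite -mul2n => ->.
have jn : ((k - d)./2 < n)%N.
  by have := ltn_ord k; lia.
have keq : (k = d + odd (k - d) + 2 * (k - d)./2 :> nat)%N.
  by rewrite -addnA -kE subnKC.
move: keq jn; set j0 := (k - d)./2; set b := odd (k - d) => keq jn.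
rewrite (bigD1 (Ordinal jn))//= big1 => [|j jj0]; last first.
  have jj : (j : nat) != j0 by apply: contra jj0 => /eqP jE; apply/eqP/val_inj.
  rewrite !qE; do 2 (case: eqP => [?|_]; first by move/eqP: jj; lia).
  by rewrite !mulr0 subrr mulr0.
rewrite !yE !qE {}keq; case: b.
  have -> : ((d + 2 * j0)%N == (d + true + 2 * j0)%N) = false by apply/eqP; lia.
  have -> : ((d + 2 * j0).+1 == (d + true + 2 * j0)%N) by apply/eqP; lia.
  by field.
have -> : ((d + 2 * j0)%N == (d + false + 2 * j0)%N) by apply/eqP; lia.
have -> : ((d + 2 * j0).+1 == (d + false + 2 * j0)%N) = false by apply/eqP; lia.
by field.
Qed.

(* Both kinds of projections of the product take values in the same R^(m+m'+1):
   the coordinates (x, t, x', t') are concatenated, with the first or the second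
   block replaced by its projection. *)
Definition pibar_seq d n (alpha : n.-tuple R) d' n' (alpha' : n'.-tuple R)
    (j : 'I_(d + 2 * n + (d' + 2 * n')))
    (p : ((d + 2 * n).-tuple R * R) * ((d' + 2 * n').-tuple R * R)) : seq R :=
  match fintype.split j with
  | inl k => proj alpha k p.1 ++ rcons p.2.1 p.2.2
  | inr k => rcons p.1.1 p.1.2 ++ proj alpha' k p.2
  end.

Lemma size_pibar d n (alpha : n.-tuple R) d' n' (alpha' : n'.-tuple R)
    (j : 'I_(d + 2 * n + (d' + 2 * n')))
    (p : ((d + 2 * n).-tuple R * R) * ((d' + 2 * n').-tuple R * R)) :
  size (pibar_seq alpha alpha' j p) == (d + 2 * n + (d' + 2 * n')).+1.
Proof.
rewrite /pibar_seq; case: fintype.split => k; rewrite size_cat size_rcons;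
  by rewrite !size_tuple ?addnS ?addSn.
Qed.

Definition pibar d n (alpha : n.-tuple R) d' n' (alpha' : n'.-tuple R)
    (j : 'I_(d + 2 * n + (d' + 2 * n')))
    (p : ((d + 2 * n).-tuple R * R) * ((d' + 2 * n').-tuple R * R)) :
    (d + 2 * n + (d' + 2 * n')).+1.-tuple R :=
  Tuple (size_pibar alpha alpha' j p).

End carnot.

Section radon.
Context {R : realType}.
Local Notation mR := (measurableTypeR R).
Local Notation lambda := (@lebesgue_measure R).

Definition circle_param (theta : mR) : mR * mR := (cos theta, sin theta).

Lemma measurable_circle_param : measurable_fun [set: mR] circle_param.
Proof.
apply: measurable_fun_pair; apply: continuous_measurable_fun.
  exact: continuous_cos.
exact: continuous_sin.
Qed.

(* Arc-length measure of the unit circle, as a measure on the plane concentrated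
   on the circle. *)
Definition arc_length : set (mR * mR) -> \bar R :=
  pushforward (mrestr lambda (measurable_itv `[0, 2 * pi[)) circle_param.

Let arc_length0 : arc_length set0 = 0%E.
Proof. by rewrite /arc_length /pushforward preimage_set0 measure0. Qed.

Let arc_length_ge0 A : (0 <= arc_length A)%E.
Proof. by rewrite /arc_length /pushforward measure_ge0. Qed.

Let arc_length_sigma_additive : semi_sigma_additive arc_length.
Proof.
pose m := measure_function_pushforward__canonical__measure_function_Measure.
exact: (@measure_semi_sigma_additive _ _ _ (m _ _ _ _ _
  (mrestr lambda (measurable_itv `[0, 2 * pi[)) _ measurable_circle_param)).
Qed.

HB.instance Definition _ := isMeasure.Build _ _ _ arc_length
  arc_length0 arc_length_ge0 arc_length_sigma_additive.

(* For (s1, s2) on the unit circle, r |-> s (s1, s2) + r (- s2, s1) is an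
   arc-length parametrization of the line {x | <x, (s1, s2)> = s}; the values at
   other (s1, s2) are irrelevant, arc_length being 0 off the circle. *)
Definition radon (f : mR * mR -> R) (p : (mR * mR) * mR) : \bar R :=
  let: ((s1, s2), s) := p in
  (\int[lambda]_r (f ((s * s1 - r * s2)%R, (s * s2 + r * s1)%R))%:E)%E.

(* Operator norm L^p(R^2) -> L^q(S^1 x R), in [0, +oo]: no finiteness is built
   in. Every class in L^p has a Borel representative, so f ranges over Borel
   functions, whose integral along every line makes sense. *)
Definition radon_norm (p q : R) : \bar R :=
  ereal_sup [set ('N[arc_length \x lambda]_q%:E [radon f])%E | f in
    [set f : mR * mR -> R | measurable_fun setT f /\
      ('N[lambda \x lambda]_p%:E [EFin \o f] <= 1)%E]].

End radon.

Section carnot_lebesgue.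
Context {R : realType}.
Local Notation mR := (measurableTypeR R).
Variable m : nat.

(* A synonym for the product measure, so that it carries a sigma-finite
   structure. *)
Definition carnot_lebesgue : set (m.-tuple mR * mR) -> \bar R :=
  (borel_lebesgue m \x @lebesgue_measure R)%E.

HB.instance Definition _ := Measure.on carnot_lebesgue.

HB.instance Definition _ := Measure_isSigmaFinite.Build _ _ _ carnot_lebesgue
  (sigma_finite_product (borel_lebesgue m) (@lebesgue_measure R)).

End carnot_lebesgue.

(* Lebesgue measure on the Lebesgue (Caratheodory) sigma-algebra, that is, the
   completion of the Borel version. *)
Section completed.
Context {R : realType}.

Definition lebesgue_tuple n :=
  @completed_measure_extension _ _ _ (@borel_lebesgue R n).

HB.instance Definition _ n := Measure.on (@lebesgue_tuple n).

Definition lebesgue_measurable_fun n (f : n.-tuple R -> \bar R) : Prop :=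
  measurable_fun [set: caratheodory_type (@borel_lebesgue R n)^*%mu] f.

Definition lebesgue_carnot2 m m' :=
  @completed_measure_extension _ _ _
    (@carnot_lebesgue R m \x @carnot_lebesgue R m')%E.

HB.instance Definition _ m m' := Measure.on (@lebesgue_carnot2 m m').

End completed.
Arguments lebesgue_tuple {R} n, _.
Arguments lebesgue_carnot2 {R} m m', _ _.

(* Main.v *)
From HB Require Import structures.
Require Import Defs.
From mathcomp Require Import all_boot all_order all_algebra.
From mathcomp Require Import all_classical all_reals all_analysis.
From mathcomp Require Import measurable_realfun ring lra zify.

(** Writing F_j = f_j^(p_j) and w_j = 1/p_j, the inequality takes the form

      int prod_j F_j(pi_j)^(w_j)  <=  C prod_j (int F_j)^(w_j),

    in which only the weights w_j vary, not the functions. All the steps below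
    are stated in this form. Its advantage is that weighted Hoelder
    ([hoelder_poweR]) both integrates such products one variable at a time and
    combines inequalities with different weights: if the inequality holds with
    weights w and with weights w', it holds with every convex combination of
    them, the constants being combined geometrically.

    The analytic input is the Heisenberg group, d = 0 and n = 1
    ([heisenberg_bound]). A translation in t makes the first function
    independent of the first coordinate a; integrating the second one over a is
    then an integral over the line {(a, s - b a)}. Such a line has the normal
    direction (cos theta, sin theta) with b = cot theta, and with exponent 3 the
    Jacobians of theta -> b and of the arc length cancel exactly: the L^3 norm
    in (b, s) of the integral over the line is the L^3 norm of the Radon
    transform over a half circle ([slope_int_radon], [slope_int_bound]). Hoelder
    with exponents 3/2 and 3 concludes.

    For one group of dimension m + 1, m = d + 2n, single out one of the n pairs
    of coordinates, say u, v ([one_pair_bound]): the two functions attached to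
    the pair get the weight 2/(m+1), the others 1/(m+1). Integrate first in t, u
    and v. Hoelder detaches the other functions, and because each of them
    differs from a function of (the remaining coordinates, t) by a translation
    in t only, the integral in t removes every trace of the group law from
    them; the pair itself is the Heisenberg case. What is left is a
    Loomis-Whitney inequality, the k-th function being independent of x_k, and
    it follows from Hoelder applied to one coordinate after another
    ([coords_int_finner]). The geometric mean over the n pairs gives the weights
    1/(m+1) and (n+1)/(n(m+1)) ([carnot_bound]).

    For a product of two groups, apply Hoelder on the first group, the functions
    of the second group being extra factors, and then on the second group
    ([product_bound]); the weights of the two groups are scaled by (m+1)/N and
    (m'+1)/N.

    Finally a Lebesgue measurable function has a Borel majorant to which it is
    equal almost everywhere ([borel_majorant]). Since the majorant is larger at
    every point, it can only increase the left-hand side, and it leaves the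
    norms on the right-hand side unchanged. *)

Set Implicit Arguments.
Unset Strict Implicit.
Unset Printing Implicit Defensive.
Import Order.TTheory GRing.Theory Num.Theory.
Import numFieldNormedType.Exports.
Local Open Scope classical_set_scope.
Local Open Scope ring_scope.
Local Open Scope ereal_scope.

(** * Powers of extended reals and the weighted Hoelder inequality *)

Section poweR_lemmas.
Context {R : realType}.
Implicit Types x y : \bar R.

Lemma eq_lee x y : x = y -> x <= y.
Proof. by move=> ->. Qed.

Lemma ge0_le_poweR x y (r : R) : (0 <= r)%R -> 0 <= x -> x <= y ->
  x `^ r <= y `^ r.
Proof.
move=> r0 x0 xy; apply: gt0_ler_poweR => //; rewrite in_itv/= leey andbT//.
exact: le_trans xy.
Qed.

(** Nonnegative exponents make this hold without conditions on x: the product of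
    0 and infinity never occurs, unlike for x ^ 1 and x ^ (-1). *)
Lemma ge0_poweRD x (r s : R) : (0 <= r)%R -> (0 <= s)%R ->
  x `^ (r + s) = x `^ r * x `^ s.
Proof.
move=> r0 s0; have [->|rn0] := eqVneq r 0%R.
  by rewrite add0r poweRe0 mul1e.
have rp : (0 < r)%R by rewrite lt_neqAle eq_sym rn0.
by rewrite poweRD// add_neq0_poweRD_def// gt_eqF// ltr_wpDr.
Qed.

Lemma poweR_prod (I : Type) (s : seq I) (P : pred I) (F : I -> \bar R) (r : R) :
  (forall i, 0 <= F i) ->
  (\prod_(i <- s | P i) F i) `^ r = \prod_(i <- s | P i) F i `^ r.
Proof.
move=> F0; elim: s => [|i s IHs]; first by rewrite !big_nil poweR1r.
by rewrite !big_cons; case: ifP => // _; rewrite poweRM ?IHs// prode_ge0.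
Qed.

(** The weighted inequality between arithmetic and geometric means, with
    infinite values allowed. *)
Lemma young_poweR x y (a b : R) : (0 < a)%R -> (0 < b)%R -> (a + b = 1)%R ->
  0 <= x -> 0 <= y -> x `^ a * y `^ b <= a%:E * x + b%:E * y.
Proof.
move=> a0 b0 ab1.
case: x => [x||]// x0; last first.
  case: y => [y||]// y0; rewrite gt0_muley ?lte_fin// ?addye ?leey//.
  by rewrite gt_eqF// (lt_le_trans _ (mule_ge0 _ y0))// ?lee_fin ?ltNy0// ltW.
case: y => [y||]// y0; last by rewrite [b%:E * _]gt0_muley ?lte_fin// addey ?leey.
rewrite -!EFinM -EFinD lee_fin.
have := @conjugate_powR _ (x `^ a)%R (y `^ b)%R (a^-1)%R (b^-1)%R.
rewrite !powR_ge0 !invr_gt0 !invrK -!powRrM !mulfV ?gt_eqF// !powRr1//.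
by rewrite [(_ * x)%R]mulrC [(_ * y)%R]mulrC; exact.
Qed.

Lemma poweRVK (x : \bar R) (p : R) : (p != 0)%R -> 0 <= x ->
  (x `^ p) `^ p^-1 = x.
Proof. by move=> p0 x0; rewrite -poweRrM divff// poweRe1. Qed.

Lemma poweR_sum (I : Type) (s : seq I) (P : pred I) (x : \bar R) (a : I -> R) :
  (forall i, 0 <= a i)%R ->
  \prod_(i <- s | P i) x `^ a i = x `^ (\sum_(i <- s | P i) a i)%R.
Proof.
move=> a0; elim: s => [|i s IHs]; first by rewrite !big_nil poweRe0.
rewrite !big_cons; case: ifP => // _; rewrite IHs ge0_poweRD//.
by apply: sumr_ge0.
Qed.

Lemma ge0_le_prod (I : Type) (s : seq I) (P : pred I) (x y : I -> \bar R) :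
  (forall i, 0 <= x i) -> (forall i, x i <= y i) ->
  \prod_(i <- s | P i) x i <= \prod_(i <- s | P i) y i.
Proof.
move=> x0 xy; elim: s => [|i s IHs]; first by rewrite !big_nil.
by rewrite !big_cons; case: ifP => // _; apply: lee_pmul => //; apply: prode_ge0.
Qed.

End poweR_lemmas.

Section hoelder.
Context d (T : measurableType d) {R : realType} (mu : {measure set T -> \bar R}).

(** The integral of a nonnegative function is a supremum over the simple
    functions below it, so that monotonicity needs no measurability. *)
Lemma le_integralT (f g : T -> \bar R) : (forall x, 0 <= f x) ->
  (forall x, f x <= g x) -> \int[mu]_x f x <= \int[mu]_x g x.
Proof.
move=> f0 fg; have g0 x : 0 <= g x by exact: le_trans (fg x).
rewrite !ge0_integralTE//; apply: ge_ereal_sup => _ [h hf <-].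
by apply: ereal_sup_ubound; exists h => // x; exact: le_trans (fg x).
Qed.

Lemma measurable_fun_poweR (f : T -> \bar R) (a : R) :
  measurable_fun setT f -> measurable_fun setT (fun x => f x `^ a).
Proof. exact: measurableT_comp (measurable_poweR _). Qed.

Lemma integral_eq0_ae (f : T -> \bar R) : measurable_fun setT f ->
  (forall x, 0 <= f x) -> \int[mu]_x f x = 0 -> ae_eq mu setT f (cst 0).
Proof.
move=> mf f0 f00; apply/ae_eq_integral_abs => //.
by under eq_integral do rewrite gee0_abs//.
Qed.

Lemma ae_eq0_integral (f : T -> \bar R) : measurable_fun setT f ->
  ae_eq mu setT f (cst 0) -> \int[mu]_x f x = 0.
Proof. by move=> mf f0; rewrite (ae_eq_integral (cst 0))// integral0. Qed.

(** When an integral is 0 or infinite the inequality is checked directly;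
    otherwise f and g are normalized to have integral 1 and Young's inequality
    is integrated. *)
Lemma hoelder2_poweR (f g : T -> \bar R) (a b : R) :
  measurable_fun setT f -> measurable_fun setT g ->
  (forall x, 0 <= f x) -> (forall x, 0 <= g x) ->
  (0 <= a)%R -> (0 <= b)%R -> (a + b = 1)%R ->
  \int[mu]_x (f x `^ a * g x `^ b) <=
  (\int[mu]_x f x) `^ a * (\int[mu]_x g x) `^ b.
Proof.
move=> mf mg f0 g0; rewrite le_eqVlt => /predU1P[<- _|a0].
  rewrite add0r => ->; rewrite poweRe0 mul1e poweRe1 ?integral_ge0//.
  by apply: le_integralT => x; rewrite poweRe0 mul1e poweRe1.
rewrite le_eqVlt => /predU1P[<-|b0].
  rewrite addr0 => ->; rewrite poweRe0 mule1 poweRe1 ?integral_ge0//.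
  by apply: le_integralT => x; rewrite poweRe0 mule1 poweRe1.
move=> ab1.
set A := \int[mu]_x f x; set B := \int[mu]_x g x.
have A0 : 0 <= A by exact: integral_ge0.
have B0 : 0 <= B by exact: integral_ge0.
have mfg : measurable_fun setT (fun x => f x `^ a * g x `^ b).
  by apply: emeasurable_funM; exact: measurable_fun_poweR.
have [A00|An0] := eqVneq A 0.
  rewrite A00 poweR0r ?gt_eqF// mul0e ae_eq0_integral//.
  apply: filterS (integral_eq0_ae mf f0 A00) => x /= /(_ I) -> _.
  by rewrite poweR0r ?gt_eqF// mul0e.
have [B00|Bn0] := eqVneq B 0.
  rewrite B00 poweR0r ?gt_eqF// mule0 ae_eq0_integral//.
  apply: filterS (integral_eq0_ae mg g0 B00) => x /= /(_ I) -> _.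
  by rewrite poweR0r ?gt_eqF// mule0.
have Apos : 0 < A by rewrite lt0e An0.
have Bpos : 0 < B by rewrite lt0e Bn0.
have [->|Aoo] := eqVneq A +oo.
  by rewrite poweRyr ?gt_eqF// gt0_mulye ?leey// poweR_gt0.
have [->|Boo] := eqVneq B +oo.
  by rewrite poweRyr ?gt_eqF// gt0_muley ?leey// poweR_gt0.
have Afin : A \is a fin_num by rewrite ge0_fin_numE// ltey.
have Bfin : B \is a fin_num by rewrite ge0_fin_numE// ltey.
pose p := fine A; pose q := fine B.
have p0 : (0 < p)%R by rewrite fine_gt0// Apos ltey.
have q0 : (0 < q)%R by rewrite fine_gt0// Bpos ltey.
pose u x := p^-1%:E * f x; pose v x := q^-1%:E * g x.
have u0 x : 0 <= u x by apply: mule_ge0 => //; rewrite lee_fin invr_ge0 ltW.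
have v0 x : 0 <= v x by apply: mule_ge0 => //; rewrite lee_fin invr_ge0 ltW.
have mu_ : measurable_fun setT u by exact: measurable_funeM.
have mv : measurable_fun setT v by exact: measurable_funeM.
have E x : f x `^ a * g x `^ b = A `^ a * B `^ b * (u x `^ a * v x `^ b).
  rewrite muleACA -!poweRM// /u /v -[A]fineK// -[B]fineK// !muleA -!EFinM.
  by rewrite !mulfV ?gt_eqF// !mul1e.
have K0 : 0 <= A `^ a * B `^ b by rewrite mule_ge0// poweR_ge0.
under eq_integral do rewrite E.
rewrite ge0_integralZl//; last 2 first.
- by apply: emeasurable_funM; exact: measurable_fun_poweR.
- by move=> x _; rewrite mule_ge0// poweR_ge0.
rewrite -[leRHS]mule1; apply: lee_wpmul2l => //.
apply: (@le_trans _ _ (\int[mu]_x (a%:E * u x + b%:E * v x))).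
  apply: le_integralT => x; first by rewrite mule_ge0// poweR_ge0.
  exact: young_poweR.
rewrite ge0_integralD//; last 4 first.
- by move=> x _; rewrite mule_ge0// lee_fin ltW.
- exact: measurable_funeM.
- by move=> x _; rewrite mule_ge0// lee_fin ltW.
- exact: measurable_funeM.
rewrite !ge0_integralZl//; do ?by rewrite lee_fin ?invr_ge0 ltW.
  rewrite -/A -/B -[A]fineK// -[B]fineK// -!EFinM -/p -/q.
  by rewrite !mulVf ?gt_eqF// !mulr1 -EFinD ab1.
Qed.

(** Weighted Hoelder with one factor singled out: the induction on the list
    merges this factor with the head of the list, and the singled-out form is
    what the integration over one of two groups uses. *)
Lemma hoelder_poweR_head (I : Type) (s : seq I) (P : pred I) (F : I -> T -> \bar R)
    (w : I -> R) (g : T -> \bar R) (a : R) :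
  (forall i, measurable_fun setT (F i)) -> (forall i x, 0 <= F i x) ->
  (forall i, 0 <= w i)%R -> measurable_fun setT g ->
  (forall x, 0 <= g x) -> (0 <= a)%R -> (a + \sum_(i <- s | P i) w i = 1)%R ->
  \int[mu]_x (g x `^ a * \prod_(i <- s | P i) F i x `^ w i) <=
  (\int[mu]_x g x) `^ a * \prod_(i <- s | P i) (\int[mu]_x F i x) `^ w i.
Proof.
move=> mF F0 w0.
elim: s g a => [|i s IHs] g a mg g0 a0.
  rewrite !big_nil addr0 => ->; rewrite poweRe1 ?integral_ge0// mule1.
  by apply: le_integralT => x; rewrite big_nil poweRe1 ?mule1.
rewrite !big_cons; case: ifPn => Pi; last first.
  by move=> /IHs; under eq_integral do rewrite big_cons (negbTE Pi); exact.
rewrite addrA => aw1; under eq_integral do rewrite big_cons Pi muleA.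
rewrite muleA; have [aw0|awn0] := eqVneq (a + w i)%R 0%R.
  have aE : a = 0%R by apply: le_anti; rewrite a0 andbT -aw0 ler_wpDr.
  move: aw0; rewrite aE add0r => wE; rewrite wE !poweRe0 mule1.
  have /IHs := aw1; rewrite aE wE add0r => /(_ _ mg g0 (lexx _)).
  under eq_integral do rewrite poweRe0 mul1e.
  move=> h; under eq_integral do rewrite !poweRe0 !mul1e.
  by move: h; rewrite poweRe0.
have aw : (0 < a + w i)%R by rewrite lt_neqAle eq_sym awn0 addr_ge0.
pose c := (a + w i)%R; rewrite -/c in aw aw1 awn0.
pose h x := g x `^ (a / c) * F i x `^ (w i / c).
have mh : measurable_fun setT h.
  by apply: emeasurable_funM; exact: measurable_fun_poweR.
have h0 x : 0 <= h x by rewrite mule_ge0// poweR_ge0.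
have hE x : h x `^ c = g x `^ a * F i x `^ w i.
  by rewrite poweRM ?poweR_ge0// -!poweRrM !divfK.
have := IHs h c mh h0 (ltW aw) aw1.
under eq_integral do rewrite hE.
move=> /le_trans; apply; rewrite lee_wpmul2r ?prode_ge0//.
  by move=> k; rewrite poweR_ge0.
have -> : (\int[mu]_x g x) `^ a * (\int[mu]_x F i x) `^ w i =
    ((\int[mu]_x g x) `^ (a / c) * (\int[mu]_x F i x) `^ (w i / c)) `^ c.
  by rewrite poweRM ?poweR_ge0// -!poweRrM !divfK.
apply: ge0_le_poweR; [exact: ltW|exact: integral_ge0|].
apply: hoelder2_poweR => //; rewrite ?divr_ge0// ?ltW//.
by rewrite -mulrDl divff.
Qed.

Lemma hoelder_poweR (I : Type) (s : seq I) (P : pred I) (F : I -> T -> \bar R)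
    (w : I -> R) :
  (forall i, measurable_fun setT (F i)) -> (forall i x, 0 <= F i x) ->
  (forall i, 0 <= w i)%R -> (\sum_(i <- s | P i) w i = 1)%R ->
  \int[mu]_x (\prod_(i <- s | P i) F i x `^ w i) <=
  \prod_(i <- s | P i) (\int[mu]_x F i x) `^ w i.
Proof.
move=> mF F0 w0 w1.
have := @hoelder_poweR_head _ s P F w (cst 1) 0%R mF F0 w0
  (measurable_cst _) (fun=> lee01) (lexx _).
rewrite w1 add0r poweRe0 mul1e => /(_ erefl); apply: le_trans.
by apply: eq_lee; apply: eq_integral => x _; rewrite poweRe0 mul1e.
Qed.

End hoelder.

(** * Integrating out the coordinates of a tuple *)

Section nonneg_measurable.
Context {R : realType}.

(** The functions for which Tonelli's theorem holds, infinite values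
    included. *)
Definition nnmeas d (T : measurableType d) (f : T -> \bar R) :=
  measurable_fun setT f /\ forall x, 0 <= f x.

Context d1 d2 (T1 : measurableType d1) (T2 : measurableType d2).

Lemma nnmeas_comp (f : T2 -> \bar R) (g : T1 -> T2) :
  nnmeas f -> measurable_fun setT g -> nnmeas (f \o g).
Proof.
by move=> [mf f0] mg; split=> [|x]; [exact: measurableT_comp mf mg|exact: f0].
Qed.

Lemma nnmeas_poweR (f : T1 -> \bar R) (a : R) :
  nnmeas f -> nnmeas (fun x => f x `^ a).
Proof.
by move=> [mf _]; split=> [|x]; [exact: measurable_fun_poweR|exact: poweR_ge0].
Qed.

Lemma nnmeasM (f g : T1 -> \bar R) :
  nnmeas f -> nnmeas g -> nnmeas (fun x => f x * g x).
Proof.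
by move=> [mf f0] [mg g0]; split=> [|x]; [exact: emeasurable_funM|exact: mule_ge0].
Qed.

Lemma nnmeas_prod (I : Type) (s : seq I) (P : pred I) (f : I -> T1 -> \bar R) :
  (forall i, nnmeas (f i)) -> nnmeas (fun x => \prod_(i <- s | P i) f i x).
Proof.
move=> fP; split=> [|x]; last by apply: prode_ge0 => i _; exact: (fP i).2.
elim: s => [|i s IHs]; first by under eq_fun do rewrite big_nil; exact: measurable_cst.
case Pi: (P i); under eq_fun do rewrite big_cons Pi; last exact: IHs.
by apply: emeasurable_funM => //; exact: (fP i).1.
Qed.

Lemma nnmeas_int (m2 : {sigma_finite_measure set T2 -> \bar R})
    (f : T1 * T2 -> \bar R) :
  nnmeas f -> nnmeas (fun x => \int[m2]_y f (x, y)).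
Proof.
move=> [mf f0]; split=> [|x]; last exact: integral_ge0.
exact: measurable_fun_fubini_tonelli_F.
Qed.

Lemma nnmeas_integralZl (mu : {measure set T1 -> \bar R}) (f : T1 -> \bar R)
    (k : \bar R) : nnmeas f -> 0 <= k ->
  \int[mu]_x (k * f x) = k * \int[mu]_x f x.
Proof. by move=> [mf f0] k0; exact: ge0_integralZl. Qed.

End nonneg_measurable.

Section coordinates.
Context {R : realType}.
Local Notation mR := (measurableTypeR R).
Local Notation lambda := (@lebesgue_measure R).

Definition set_coord n (x : n.-tuple mR) (i : 'I_n) (a : mR) : n.-tuple mR :=
  [tuple if j == i then a else tnth x j | j < n].

Lemma tnth_set_coord n (x : n.-tuple mR) i a j :
  tnth (set_coord x i a) j = if j == i then a else tnth x j.
Proof. by rewrite tnth_mktuple. Qed.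

Lemma set_coordC n (x : n.-tuple mR) i j a b :
  i != j -> set_coord (set_coord x i a) j b = set_coord (set_coord x j b) i a.
Proof.
move=> ij; apply: eq_from_tnth => k; rewrite !tnth_set_coord.
by case: eqP => // ->; rewrite eq_sym (negbTE ij).
Qed.

Lemma measurable_set_coord n (i : 'I_n) :
  measurable_fun setT (fun p : n.-tuple mR * mR => set_coord p.1 i p.2).
Proof.
apply/measurable_fun_tnthP => j.
rewrite (_ : _ \o _ = fun p => if j == i then p.2 else tnth p.1 j); last first.
  by apply/funext => p /=; rewrite tnth_set_coord.
case: (j == i); first exact: measurable_snd.
exact: measurableT_comp (measurable_tnth j) measurable_fst.
Qed.

Lemma nnmeas_set_coord n (i : 'I_n) (G : n.-tuple mR -> \bar R) :
  nnmeas G -> nnmeas (fun p : n.-tuple mR * mR => G (set_coord p.1 i p.2)).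
Proof. by move=> GP; exact: (nnmeas_comp GP (measurable_set_coord i)). Qed.

Lemma measurable_set_coordr n (i : 'I_n) x : measurable_fun setT (set_coord x i).
Proof.
exact: (measurableT_comp (measurable_set_coord i) (measurable_pair1 x)).
Qed.

Definition coord_int n (i : 'I_n) (G : n.-tuple mR -> \bar R) (x : n.-tuple mR) :=
  \int[lambda]_a G (set_coord x i a).

Lemma nnmeas_coord_int n (i : 'I_n) G : nnmeas G -> nnmeas (coord_int i G).
Proof. by move=> GP; exact: (nnmeas_int _ (nnmeas_set_coord i GP)). Qed.

(** Tonelli's theorem on the plane of the i-th and j-th coordinates. *)
Lemma coord_intC n (i j : 'I_n) G : nnmeas G ->
  coord_int i (coord_int j G) = coord_int j (coord_int i G).
Proof.
move=> GP; have [->//|ij] := eqVneq i j; apply/funext => x; rewrite /coord_int.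
have [mG G0] : nnmeas (fun p : mR * mR => G (set_coord (set_coord x i p.1) j p.2)).
  apply: (nnmeas_comp (g := fun p : mR * mR => (set_coord x i p.1, p.2))
    (nnmeas_set_coord j GP)).
  apply: measurable_fun_pair; last exact: measurable_snd.
  exact: measurableT_comp (@measurable_set_coordr _ i x) measurable_fst.
rewrite (fubini_tonelli (fun p : mR * mR => G (set_coord (set_coord x i p.1) j p.2))
  mG G0).
apply: eq_integral => b _; apply: eq_integral => a _ /=.
by rewrite set_coordC.
Qed.

(** Iterated integration over the coordinates in s. The result is still a
    function of all the coordinates, constant in those of s, so that all the
    steps of an iterated integration live on the same space. *)
Definition coords_int n (s : seq 'I_n) (G : n.-tuple mR -> \bar R) :=
  foldr (@coord_int n) G s.

Lemma nnmeas_coords_int n (s : seq 'I_n) G : nnmeas G -> nnmeas (coords_int s G).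
Proof. by move=> GP; elim: s => //= i s; exact: nnmeas_coord_int. Qed.

Lemma coords_int_cat n (s1 s2 : seq 'I_n) G :
  coords_int (s1 ++ s2) G = coords_int s1 (coords_int s2 G).
Proof. by rewrite /coords_int foldr_cat. Qed.

(** A coordinate of s can be brought to the front by transpositions. *)
Lemma coords_int_perm n (s1 s2 : seq 'I_n) G : nnmeas G -> perm_eq s1 s2 ->
  coords_int s1 G = coords_int s2 G.
Proof.
move=> GP; have front i s : i \in s -> coords_int s G = coords_int (i :: rem i s) G.
  elim: s => //= j s IHs; rewrite inE.
  have [->//|ij /= js] := eqVneq j i.
  by rewrite (IHs js) /= coord_intC; [|exact: nnmeas_coords_int].
elim: s1 s2 => [|i s1 IHs] s2.
  by move=> /perm_size/eqP; rewrite eq_sym size_eq0 => /eqP ->.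
move=> p; have is2 : i \in s2 by rewrite -(perm_mem p) mem_head.
rewrite (front _ _ is2) /= (IHs (rem i s2))//.
by rewrite -(perm_cons i) (perm_trans p)// perm_to_rem.
Qed.

Lemma le_coords_int n (s : seq 'I_n) (G H : n.-tuple mR -> \bar R) :
  (forall x, 0 <= G x) -> (forall x, G x <= H x) ->
  forall x, coords_int s G x <= coords_int s H x.
Proof.
move=> G0 GH; elim: s => //= i s IHs x; apply: le_integralT => [a|a]; last exact: IHs.
elim: s {IHs x} (set_coord x i a) => //= j s IHs x.
by apply: integral_ge0 => b _.
Qed.

(** The inverse of the deletion of the k-th coordinate. *)
Definition insert_coord n (k : 'I_n.+1) (a : mR) (y : n.-tuple mR) : n.+1.-tuple mR :=
  [tuple if unlift k i is Some j then tnth y j else a | i < n.+1].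

Lemma tnth_insert_coord_lift n (k : 'I_n.+1) a y i :
  tnth (insert_coord k a y) (lift k i) = tnth y i.
Proof. by rewrite tnth_mktuple liftK. Qed.

Lemma tnth_insert_coord n (k : 'I_n.+1) a y : tnth (@insert_coord n k a y) k = a.
Proof. by rewrite tnth_mktuple unlift_none. Qed.

Lemma set_coord_insert_coord n (k : 'I_n.+1) a b y :
  set_coord (@insert_coord n k a y) k b = insert_coord k b y.
Proof.
apply: eq_from_tnth => i; rewrite tnth_set_coord; case: (unliftP k i) => [j|] ->.
  by rewrite eq_sym (negbTE (neq_lift _ _)) !tnth_insert_coord_lift.
by rewrite eqxx tnth_insert_coord.
Qed.

Lemma set_coord_insert_coord_lift n (k : 'I_n.+1) a b y i :
  set_coord (@insert_coord n k a y) (lift k i) b = insert_coord k a (set_coord y i b).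
Proof.
apply: eq_from_tnth => l; rewrite tnth_set_coord; case: (unliftP k l) => [j|] ->.
  by rewrite !tnth_insert_coord_lift tnth_set_coord (inj_eq lift_inj).
by rewrite (negbTE (neq_lift _ _)) !tnth_insert_coord.
Qed.

Lemma insert_coord_tnth n (k : 'I_n.+1) (x : n.+1.-tuple mR) :
  exists y, x = insert_coord k (tnth x k) y.
Proof.
exists [tuple tnth x (lift k i) | i < n]; apply: eq_from_tnth => i.
by case: (unliftP k i) => [j|] ->; rewrite ?tnth_insert_coord_lift ?tnth_insert_coord
  ?tnth_mktuple.
Qed.

Lemma measurable_insert_coord n (k : 'I_n.+1) :
  measurable_fun setT (fun p : mR * n.-tuple mR => insert_coord k p.1 p.2).
Proof.
apply/measurable_fun_tnthP => i; case: (unliftP k i) => [j|] ->.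
  rewrite (_ : _ \o _ = fun p => tnth p.2 j); last first.
    by apply/funext => p /=; rewrite tnth_insert_coord_lift.
  exact: measurableT_comp (measurable_tnth j) measurable_snd.
rewrite (_ : _ \o _ = fst); first exact: measurable_fst.
by apply/funext => p /=; rewrite tnth_insert_coord.
Qed.

(** A coordinate that is not integrated can be frozen. *)
Lemma coords_int_insert_coord n (k : 'I_n.+1) (s : seq 'I_n) G a y :
  coords_int (map (lift k) s) G (insert_coord k a y) =
  coords_int s (fun y => G (insert_coord k a y)) y.
Proof.
elim: s y => //= i s IHs y; apply: eq_integral => b _.
by rewrite set_coord_insert_coord_lift IHs.
Qed.

Lemma integral_cons n (G : n.+1.-tuple mR -> \bar R) : nnmeas G ->
  \int[borel_lebesgue n.+1]_x G x =
  \int[lambda]_a \int[borel_lebesgue n]_y G [tuple of a :: y].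
Proof.
move=> GP; have [mG G0] := nnmeas_comp GP (@measurable_consp R n).
case: GP => mG' G0'.
rewrite [LHS](ge0_integral_pushforward (@measurable_consp R n) _ measurableT mG').
  by rewrite preimage_setT (fubini_tonelli1 _ mG G0).
by move=> y _; exact: G0'.
Qed.

(** By induction on the dimension, the measure on R^(n+1) being the image of a
    product measure under the adjunction of a first coordinate. *)
Lemma coords_int_enum n (G : n.-tuple mR -> \bar R) x : nnmeas G ->
  coords_int (enum 'I_n) G x = \int[borel_lebesgue n]_x G x.
Proof.
elim: n G x => [|n IHn] G x GP.
  rewrite (size0nil (size_enum_ord 0)) /=.
  rewrite integral_dirac ?diracT ?mul1e//; last by case: GP.
  by rewrite (tuple0 x).
rewrite integral_cons// enum_ordSl /= /coord_int; apply: eq_integral => a _.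
have [y ->] := insert_coord_tnth ord0 x.
rewrite set_coord_insert_coord coords_int_insert_coord IHn.
  apply: eq_integral => z _; congr G; apply: eq_from_tnth => i.
  by case: (unliftP ord0 i) => [j|] ->; rewrite ?tnth_insert_coord_lift ?tnthS
    ?tnth_insert_coord ?tnth0.
apply: (nnmeas_comp GP).
exact: (measurableT_comp (measurable_insert_coord ord0) (measurable_pair1 a)).
Qed.

Lemma perm_enum_lift n (k : 'I_n.+1) :
  perm_eq (enum 'I_n.+1) (k :: map (lift k) (enum 'I_n)).
Proof.
apply: uniq_perm; rewrite ?enum_uniq//=.
  rewrite map_inj_uniq ?enum_uniq ?andbT; last exact: lift_inj.
  by apply/mapP => -[i _ /eqP]; rewrite (negbTE (neq_lift _ _)).
move=> i; rewrite mem_enum [RHS]inE [LHS]inE; apply/esym.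
case: (unliftP k i) => [j|] ->; last by rewrite eqxx.
by rewrite map_f ?orbT// mem_enum.
Qed.

(** Lebesgue measure treats all the coordinates alike: any of them can be split
    off, although the measure is defined by splitting off the first one. *)
Lemma integral_insert_coord n (k : 'I_n.+1) (G : n.+1.-tuple mR -> \bar R) : nnmeas G ->
  \int[borel_lebesgue n.+1]_x G x =
  \int[borel_lebesgue n]_y \int[lambda]_a G (insert_coord k a y).
Proof.
move=> GP; have GkP : nnmeas (fun p : mR * n.-tuple mR => G (insert_coord k p.1 p.2)).
  exact: (nnmeas_comp GP (measurable_insert_coord k)).
have [mGk Gk0] := GkP.
rewrite -(fubini_tonelli (fun p : mR * n.-tuple mR =>
  G (insert_coord k p.1 p.2)) mGk Gk0).
rewrite -(coords_int_enum [tuple 0%R | i < n.+1] GP).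
rewrite (coords_int_perm GP (perm_enum_lift k)) /=.
apply: eq_integral => a _.
have [y ->] := insert_coord_tnth k [tuple 0%R | i < n.+1].
rewrite set_coord_insert_coord coords_int_insert_coord coords_int_enum//.
apply: (nnmeas_comp GP).
exact: (measurableT_comp (measurable_insert_coord k) (measurable_pair1 a)).
Qed.

End coordinates.

(** * Deleting a coordinate, and the Loomis-Whitney inequality *)

Section loomis_whitney.
Context {R : realType}.
Local Notation mR := (measurableTypeR R).
Local Notation lambda := (@lebesgue_measure R).

Lemma insert_coord_max_rcons n (a : mR) (y : n.-tuple mR) :
  insert_coord ord_max a y = rcons y a :> seq R.
Proof.
apply: (@eq_from_nth _ 0%R); first by rewrite size_tuple size_rcons size_tuple.
rewrite size_tuple => i lti.
rewrite -[i]/(nat_of_ord (Ordinal lti)) -tnth_nth nth_rcons size_tuple.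
case: (unliftP ord_max (Ordinal lti)) => [j|] ->.
  by rewrite tnth_insert_coord_lift lift_max ltn_ord (tnth_nth 0%R).
by rewrite tnth_insert_coord /= ltnn eqxx.
Qed.

Lemma integral_rcons n (c : n.-tuple mR -> mR -> n.+1.-tuple mR)
    (G : n.+1.-tuple mR -> \bar R) :
  (forall y s, c y s = rcons y s :> seq R) -> nnmeas G ->
  \int[borel_lebesgue n.+1]_x G x =
  \int[borel_lebesgue n]_y \int[lambda]_s G (c y s).
Proof.
move=> cE /(integral_insert_coord ord_max) ->.
apply: eq_integral => y _; apply: eq_integral => s _; congr G.
by apply: val_inj; rewrite /= cE; exact: insert_coord_max_rcons.
Qed.

Lemma measurable_cat_tuple n k :
  measurable_fun setT (fun p : n.-tuple mR * k.-tuple mR => [tuple of p.1 ++ p.2]).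
Proof.
apply/measurable_fun_tnthP => i; case: (split_ordP i) => j ->.
  rewrite (_ : _ \o _ = fun p => tnth p.1 j); last first.
    by apply/funext => p /=; rewrite tnth_lshift.
  exact: measurableT_comp (measurable_tnth j) measurable_fst.
rewrite (_ : _ \o _ = fun p => tnth p.2 j); last first.
  by apply/funext => p /=; rewrite tnth_rshift.
exact: measurableT_comp (measurable_tnth j) measurable_snd.
Qed.

Lemma integral_cat_tuple n k (G : (n + k).-tuple mR -> \bar R) : nnmeas G ->
  \int[borel_lebesgue (n + k)]_x G x =
  \int[borel_lebesgue n]_y \int[borel_lebesgue k]_z G [tuple of y ++ z].
Proof.
elim: n G => [|n IHn] G GP.
  rewrite integral_dirac ?diracT ?mul1e//.
    by apply: eq_integral => z _; congr G; exact: val_inj.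
  exact: (nnmeas_int (borel_lebesgue k)
    (nnmeas_comp GP (@measurable_cat_tuple 0 k))).1.
rewrite [LHS](@integral_cons _ (n + k)) // integral_cons; last first.
  exact: (nnmeas_int (borel_lebesgue k)
    (nnmeas_comp GP (@measurable_cat_tuple n.+1 k))).
apply: eq_integral => a _; rewrite IHn; last first.
  apply: (nnmeas_comp GP).
  exact: (measurableT_comp (@measurable_consp R (n + k)) (measurable_pair1 a)).
by apply: eq_integral => y _; apply: eq_integral => z _; congr G; exact: val_inj.
Qed.

Lemma integral_cat n k m (c : n.-tuple mR -> k.-tuple mR -> m.-tuple mR)
    (G : m.-tuple mR -> \bar R) :
  (forall y z, c y z = y ++ z :> seq R) -> nnmeas G ->
  \int[borel_lebesgue m]_x G x =
  \int[borel_lebesgue n]_y \int[borel_lebesgue k]_z G (c y z).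
Proof.
move=> cE; have nkm : (n + k = m)%N.
  have := congr1 size (cE [tuple 0%R | i < n] [tuple 0%R | i < k]).
  by rewrite size_cat !size_tuple.
case: m / nkm c G cE => c G cE GP; rewrite (integral_cat_tuple GP).
apply: eq_integral => y _; apply: eq_integral => z _; congr G.
by apply: val_inj; exact/esym/cE.
Qed.

Lemma size_hat m (k : 'I_m) (x : m.-tuple R) (s : R) :
  size (rcons (delete_coord k x) s) == m.
Proof.
rewrite size_rcons size_cat size_take size_drop size_tuple ltn_ord.
by rewrite -addnS subnSK// subnKC// ltnW.
Qed.

(** The point usually written (x^_k, s), where x^_k is x without its k-th
    coordinate. *)
Definition hat m (k : 'I_m) (x : m.-tuple mR) (s : mR) : m.-tuple mR :=
  Tuple (size_hat k x s).

Definition remove_coord n (k : 'I_n.+1) (x : n.+1.-tuple mR) : n.-tuple mR :=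
  [tuple tnth x (lift k i) | i < n].

Lemma val_remove_coord n (k : 'I_n.+1) x : remove_coord k x = delete_coord k x :> seq R.
Proof.
apply: (@eq_from_nth _ 0%R).
  rewrite /delete_coord size_tuple size_cat size_take size_drop size_tuple ltn_ord.
  by rewrite subSS subnKC// -ltnS.
rewrite size_tuple => i lti.
rewrite -[in LHS](_ : nat_of_ord (Ordinal lti) = i)// -tnth_nth tnth_mktuple.
rewrite (tnth_nth 0%R) /= /delete_coord nth_cat size_take size_tuple ltn_ord /bump.
case: ltnP => ik.
  by rewrite nth_take// leqNgt ik.
rewrite nth_drop /=; congr nth; lia.
Qed.

Lemma hatE n (k : 'I_n.+1) x s : hat k x s = insert_coord ord_max s (remove_coord k x).
Proof. by apply: val_inj; rewrite /= insert_coord_max_rcons val_remove_coord. Qed.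

Lemma remove_coord_insert_coord n (k : 'I_n.+1) a y :
  remove_coord k (insert_coord k a y) = y.
Proof. by apply: eq_from_tnth => i; rewrite tnth_mktuple tnth_insert_coord_lift. Qed.

Lemma hat_set_coord m (k : 'I_m) x a s : hat k (set_coord x k a) s = hat k x s.
Proof.
case: m k x => [[]//|m] k x; rewrite !hatE.
have [y ->] := insert_coord_tnth k x.
by rewrite set_coord_insert_coord !remove_coord_insert_coord.
Qed.

Lemma measurable_hat m (k : 'I_m) :
  measurable_fun setT (fun p : m.-tuple mR * mR => hat k p.1 p.2).
Proof.
case: m k => [[]//|m] k; under eq_fun do rewrite hatE.
pose g (p : m.+1.-tuple mR * mR) : mR * m.-tuple mR := (p.2, remove_coord k p.1).
apply: (@measurableT_comp _ _ _ _ _ _ (fun p => insert_coord ord_max p.1 p.2) _ g).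
  exact: measurable_insert_coord.
apply: measurable_fun_pair; first exact: measurable_snd.
apply/measurable_fun_tnthP => i.
rewrite (_ : _ \o _ = fun p => tnth p.1 (lift k i)); last first.
  by apply/funext => p /=; rewrite tnth_mktuple.
exact: measurableT_comp (measurable_tnth _) measurable_fst.
Qed.

Lemma nnmeas_hat m (k : 'I_m) (F : m.-tuple mR -> \bar R) : nnmeas F ->
  nnmeas (fun p : m.-tuple mR * mR => F (hat k p.1 p.2)).
Proof. by move=> FP; exact: (nnmeas_comp FP (measurable_hat k)). Qed.

(** Up to the order of the coordinates, x^_k and s together run over the whole
    of R^m. *)
Lemma coords_int_hat m (k : 'I_m) (F : m.-tuple mR -> \bar R) x : nnmeas F ->
  coords_int [seq i <- enum 'I_m | i != k] (fun x => \int[lambda]_s F (hat k x s)) x =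
  \int[borel_lebesgue m]_y F y.
Proof.
move=> FP; have HP := nnmeas_int lambda (nnmeas_hat k FP).
case: m k F x FP HP => [[]//|m] k F x FP HP.
rewrite (coords_int_perm (s2 := map (lift k) (enum 'I_m)) HP); last first.
  have := perm_enum_lift k => /(perm_filter (fun i => i != k)) /perm_trans; apply.
  rewrite /= eqxx filter_map (eq_filter (a2 := predT)) ?filter_predT//.
  by move=> i /=; rewrite eq_sym neq_lift.
have [y ->] := insert_coord_tnth k x; rewrite coords_int_insert_coord.
rewrite (integral_insert_coord ord_max FP) -(coords_int_enum y); last first.
  apply: (nnmeas_int lambda (f := fun p => F (insert_coord ord_max p.2 p.1))).
  apply: (nnmeas_comp (f := fun p => F (insert_coord ord_max p.1 p.2))
    (g := fun p => (p.2, p.1))).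
    exact: (nnmeas_comp FP (measurable_insert_coord ord_max)).
  by apply: measurable_fun_pair; [exact: measurable_snd|exact: measurable_fst].
congr (coords_int _ _ y); apply/funext => z; apply: eq_integral => s _.
by rewrite hatE remove_coord_insert_coord.
Qed.

Definition indep m (k : 'I_m) (P : m.-tuple mR -> \bar R) :=
  forall x a, P (set_coord x k a) = P x.

Lemma indep_coords_int m (k : 'I_m) P (s : seq 'I_m) : k \notin s ->
  indep k P -> indep k (coords_int s P).
Proof.
move=> + iP; elim: s => [_|i s IHs] /=; first exact: iP.
rewrite inE negb_or => /andP[ki ks] x a; apply: eq_integral => b _.
by rewrite set_coordC// (IHs ks).
Qed.

Lemma coord_int_hoelder m (i : 'I_m) (Q : pred 'I_m)
    (P : 'I_m -> m.-tuple mR -> \bar R) (w : 'I_m -> R) x :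
  (forall k, nnmeas (P k)) -> (forall k, 0 <= w k)%R ->
  (\sum_(k | Q k) w k = 1)%R ->
  coord_int i (fun x => \prod_(k | Q k) P k x `^ w k) x <=
  \prod_(k | Q k) coord_int i (P k) x `^ w k.
Proof.
move=> PP w0 w1; apply: hoelder_poweR => // k.
  exact: (nnmeas_comp (PP k) (measurable_set_coordr i x)).1.
by move=> a; exact: (PP k).2.
Qed.

(** One step of the Loomis-Whitney induction: the factor that does not depend on
    the i-th coordinate is pulled out of the integral and Hoelder applies to the
    others. *)
Lemma coord_int_finner m (i : 'I_m) (P : 'I_m -> m.-tuple mR -> \bar R)
    (w : 'I_m -> R) x :
  (forall k, nnmeas (P k)) -> indep i (P i) -> (forall k, 0 <= w k)%R ->
  (\sum_(k | k != i) w k = 1)%R ->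
  coord_int i (fun x => \prod_k P k x `^ w k) x <=
  \prod_k (if k != i then coord_int i (P k) x else P k x) `^ w k.
Proof.
move=> PP iP w0 w1.
have H a : \prod_k P k (set_coord x i a) `^ w k =
    P i x `^ w i * \prod_(k | k != i) P k (set_coord x i a) `^ w k.
  by rewrite (bigD1 i)//= iP.
have mP k : nnmeas (fun a => P k (set_coord x i a)).
  exact: (nnmeas_comp (PP k) (measurable_set_coordr i x)).
rewrite /coord_int; under eq_integral do rewrite H.
rewrite ge0_integralZl ?poweR_ge0//; last 2 first.
- by apply: proj1; apply: nnmeas_prod => k; exact: nnmeas_poweR (mP k).
- by move=> a _; apply: prode_ge0 => k _; exact: poweR_ge0.
rewrite [leRHS](bigD1 i)//= eqxx /=; apply: lee_wpmul2l; first exact: poweR_ge0.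
rewrite [leRHS](eq_bigr (fun k => (coord_int i (P k) x) `^ w k)); last by move=> k ->.
by apply: hoelder_poweR => // k; case: (mP k).
Qed.

(** Finner's form of the Loomis-Whitney inequality, for some of the coordinates
    only. The k-th function is integrated over all of them except the k-th; the
    condition on the weights is the one for which each step is an instance of
    Hoelder's inequality. *)
Lemma coords_int_finner m (s : seq 'I_m) (P : 'I_m -> m.-tuple mR -> \bar R)
    (w : 'I_m -> R) : uniq s ->
  (forall k, nnmeas (P k)) -> (forall k, indep k (P k)) -> (forall k, 0 <= w k)%R ->
  (forall i, i \in s -> \sum_(k | k != i) w k = 1)%R ->
  forall x, coords_int s (fun x => \prod_k P k x `^ w k) x <=
  \prod_k coords_int [seq i <- s | i != k] (P k) x `^ w k.
Proof.
move=> + PP iP w0; elim: s => [_ _|i s IHs /andP[si us] w1] x; first exact: lexx.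
pose Q k := coords_int [seq j <- s | j != k] (P k).
have QP k : nnmeas (Q k) by exact: nnmeas_coords_int.
have /= := IHs us (fun j js => w1 j (@mem_behead _ (i :: s) j js)).
move=> {}IHs; apply: (@le_trans _ _ (coord_int i (fun x => \prod_k Q k x `^ w k) x)).
  apply: le_integralT => a; last exact: IHs.
  exact: (nnmeas_coords_int s
    (nnmeas_prod _ _ (fun k => nnmeas_poweR (w k) (PP k)))).2.
apply: le_trans (@coord_int_finner m i Q w x QP _ w0 (w1 i (mem_head _ _))) _.
  by apply: indep_coords_int (iP i); rewrite mem_filter eqxx.
apply: eq_lee; apply: eq_bigr => k _.
by rewrite /= eq_sym; case: ifP.
Qed.

End loomis_whitney.

(** * Changes of variable on the line *)

Section change_of_variables.
Context {R : realType}.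
Local Notation mR := (measurableTypeR R).
Local Notation lambda := (@lebesgue_measure R).

Definition push d1 d2 (T1 : measurableType d1) (T2 : measurableType d2)
    (m : {measure set T1 -> \bar R}) (f : T1 -> T2) (mf : measurable_fun setT f) :
    {measure set T2 -> \bar R} :=
  measure_function_pushforward__canonical__measure_function_Measure m mf.

Lemma integral_push d1 d2 (T1 : measurableType d1) (T2 : measurableType d2)
    (m : {measure set T1 -> \bar R}) (f : T1 -> T2) (mf : measurable_fun setT f)
    (g : T2 -> \bar R) : nnmeas g ->
  \int[push m mf]_x g x = \int[m]_x g (f x).
Proof.
move=> [mg g0]; rewrite [LHS](ge0_integral_pushforward mf _ measurableT mg).
  by rewrite preimage_setT.
by move=> x _; exact: g0.
Qed.

Lemma integral_mrestr d (T : measurableType d) (m : {measure set T -> \bar R})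
    (D : set T) (mD : measurable D) (g : T -> \bar R) : nnmeas g ->
  \int[mrestr m mD]_x g x = \int[m]_(x in D) g x.
Proof.
move=> [mg g0].
have mDC : mrestr m mD (~` D) = 0 by rewrite /mrestr setICl measure0.
rewrite (ge0_negligible_integral (measurableC mD) measurableT mg (fun x _ => g0 x) mDC).
rewrite setTD setCK; apply: eq_measure_integral => A mA AD.
by rewrite /= /mrestr setIidl.
Qed.

(** The half-open intervals generate the Borel sets and are stable under
    intersection. *)
Lemma eq_lebesgue (m : {measure set mR -> \bar R}) (f : mR -> \bar R) :
  (forall a b : R, (a < b)%R -> m `]a, b]%classic = (b - a)%:E) ->
  \int[m]_x f x = \int[lambda]_x f x.
Proof.
move=> mab; apply: eq_measure_integral => A mA _.
apply/esym/lebesgue_measure_unique => // X /ocitvP[->|[[a b] /= ab ->]].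
  by rewrite !measure0.
by rewrite mab// lebesgue_measure_itv/= lte_fin ab EFinB.
Qed.

Lemma measurable_affine (c d : R) :
  measurable_fun setT (fun x : mR => c * x + d : mR)%R.
Proof. by apply: measurable_funD => //; exact: measurable_funM. Qed.

(** This and the next lemmas follow from the uniqueness of Lebesgue measure, by
    computing the image measure of an interval. *)
Lemma integral_translate (d : R) (f : mR -> \bar R) : nnmeas f ->
  \int[lambda]_x f (x + d)%R = \int[lambda]_x f x.
Proof.
move=> fP; have mt : measurable_fun setT (fun x : mR => x + d : mR)%R.
  exact: measurable_funD.
rewrite -(integral_push lambda mt fP); apply: eq_lebesgue => a b ab.
rewrite /= /pushforward (_ : _ @^-1` _ = `](a - d)%R, (b - d)%R]%classic).
  by rewrite lebesgue_measure_itv/= lte_fin ltrD2r ab -EFinB; congr EFin; ring.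
by apply/seteqP; split=> x /=; rewrite !in_itv /= ltrBlDr lerBrDr.
Qed.

Lemma integral_opp (f : mR -> \bar R) : nnmeas f ->
  \int[lambda]_x f (- x)%R = \int[lambda]_x f x.
Proof.
move=> fP; have mt : measurable_fun setT (fun x : mR => - x : mR)%R.
  exact: oppr_measurable.
rewrite -(integral_push lambda mt fP); apply: eq_measure_integral => A mA _.
exact: lebesgue_measureN.
Qed.

Lemma integral_scale_pos (c : R) (f : mR -> \bar R) : (0 < c)%R -> nnmeas f ->
  c%:E * \int[lambda]_x f (c * x)%R = \int[lambda]_x f x.
Proof.
move=> c0 fP; have mt : measurable_fun setT (fun x : mR => c * x : mR)%R.
  exact: measurable_funM.
have c0' := ltW c0; pose cn : {nonneg R} := NngNum c0'.
rewrite -(integral_push lambda mt fP).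
have [mf f0] := fP.
rewrite -[c]/(cn%:num)%R -ge0_integral_mscale//; apply: eq_lebesgue => a b ab.
rewrite /= /mscale /= /pushforward (_ : _ @^-1` _ = `](a / c)%R, (b / c)%R]%classic).
  rewrite lebesgue_measure_itv/= lte_fin ltr_pM2r ?invr_gt0// ab -EFinB -EFinM.
  by congr EFin; field; rewrite gt_eqF.
apply/seteqP; split=> x /=;
  by rewrite !in_itv /= ltr_pdivrMr// ler_pdivlMr// !(mulrC x).
Qed.

Lemma nnmeas_affine (c d : R) (f : mR -> \bar R) : nnmeas f ->
  nnmeas (fun x : mR => f (c * x + d)%R).
Proof. by move=> fP; exact: (nnmeas_comp fP (measurable_affine c d)). Qed.

Lemma integral_affine (c d : R) (f : mR -> \bar R) : (c != 0)%R -> nnmeas f ->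
  `|c|%:E * \int[lambda]_x f (c * x + d)%R = \int[lambda]_x f x.
Proof.
move=> c0 fP; have fdP : nnmeas (fun x : mR => f (x + d)%R).
  by have := nnmeas_affine 1 d fP; under eq_fun do rewrite mul1r.
rewrite -(integral_translate d fP).
case: (ltrgtP c 0%R) c0 => // [cn|cp] _; last first.
  by rewrite gtr0_norm//; exact: (integral_scale_pos cp fdP).
have cN : (0 < - c)%R by rewrite oppr_gt0.
rewrite ltr0_norm// -(integral_scale_pos cN fdP); congr (_ * _).
rewrite -(@integral_opp (fun x => f (c * x + d)%R)); last exact: nnmeas_affine.
by apply: eq_integral => x _; rewrite mulrN mulNr.
Qed.

Section density.
Variable (w : mR -> R).
Hypothesis w0 : forall x, (0 <= w x)%R.
Hypothesis mw : measurable_fun setT w.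

Let S : set (mR * mR) := [set p | 0 <= p.2 /\ p.2 <= w p.1]%R.

Let mS : measurable S.
Proof.
rewrite (_ : S = (snd @^-1` `[(0%R : R), +oo[%classic) `&`
    ((fun p : mR * mR => w p.1 - p.2)%R @^-1` `[(0%R : R), +oo[%classic)).
  have mw2 : measurable_fun setT (fun p : mR * mR => w p.1 - p.2)%R.
    apply: measurable_funB; last exact: measurable_snd.
    exact: (measurableT_comp mw measurable_fst).
  apply: measurableI; rewrite -[X in measurable X]setTI.
    exact: (@measurable_snd _ _ mR mR measurableT _ (measurable_itv _)).
  exact: (mw2 measurableT _ (measurable_itv _)).
by apply/seteqP; split=> -[x y] /=; rewrite !in_itv/= !andbT subr_ge0.
Qed.

(** The measure with density w, realized as the image under (x, y) |-> x of
    Lebesgue measure on the subgraph {0 <= y <= w x}: a measure by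
    construction. *)
Definition density : {measure set mR -> \bar R} :=
  push (mrestr (lambda \x lambda) mS) measurable_fst.

(** Tonelli's theorem turns the integral over the subgraph of w into the
    integral against w. *)
Lemma integral_density (f : mR -> \bar R) : nnmeas f ->
  \int[density]_x f x = \int[lambda]_x (f x * (w x)%:E).
Proof.
move=> fP; rewrite integral_push// integral_mrestr; last first.
  exact: (nnmeas_comp fP measurable_fst).
rewrite integral_mkcond.
have [mf f0] := fP.
rewrite fubini_tonelli1; last 2 first.
- apply/(measurable_restrictT _ mS); apply: measurable_funTS.
  exact: (measurableT_comp mf measurable_fst).
- by move=> x; apply: erestrict_ge0.
apply: eq_integral => x _; rewrite /fubini_F.
transitivity (\int[lambda]_(y in `[0%R, w x]) (cst (f x) y)).
  rewrite [RHS]integral_mkcond; apply: eq_integral => y _; rewrite !patchE.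
  congr (if _ then _ else _).
  by apply/idP/idP; rewrite !inE /= in_itv /= => /andP.
rewrite integral_cst//= lebesgue_measure_itv/= lte_fin.
case: ltP => wx; first by rewrite EFinN oppe0 adde0.
suff -> : w x = 0%R by rewrite mule0.
by apply/eqP; rewrite eq_le wx w0.
Qed.

End density.

Lemma continuous_cauchy_density : continuous (fun x : R => (1 + x ^+ 2)^-1 : R)%R.
Proof. exact: continuous_oneDsqrV. Qed.

Lemma integral_cauchy_density (a b : R) : (a < b)%R ->
  \int[lambda]_(x in `]a, b]) ((1 + x ^+ 2)^-1)%:E = (atan b - atan a)%:E.
Proof.
move=> ab; rewrite integral_itv_obnd_cbnd; last first.
  apply/measurable_EFinP/measurable_funTS.
  exact: continuous_measurable_fun continuous_cauchy_density.
rewrite (@continuous_FTC2 _ _ (@atan R))//.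
- by apply: continuous_subspaceT; exact: continuous_cauchy_density.
- split.
  + by move=> x _; exact: derivable_atan.
  + exact/cvg_at_right_filter/continuous_atan.
  + exact/cvg_at_left_filter/continuous_atan.
- by move=> x _; rewrite derive1_atan.
Qed.

(** The inverse is written as a real power because x |-> x ^ (-1) is then known
    to be Borel on the whole line; on ]0, pi[, where sin is positive, it is the
    usual inverse. *)
Definition cot (x : mR) : mR := (cos x * (sin x `^ (-1)))%R.

Lemma measurable_cot : measurable_fun setT cot.
Proof.
apply: measurable_funM; first exact: (continuous_measurable_fun (@continuous_cos R)).
apply: (@measurableT_comp _ _ _ _ _ _ (@powR R ^~ (-1)%R)) => //.
exact: (continuous_measurable_fun (@continuous_sin R)).
Qed.

Lemma cotE (x : R) : (0 < x < pi)%R -> cot x = tan (pi / 2 - x)%R.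
Proof.
move=> x0pi; rewrite /cot /tan -[(pi / 2 - x)%R]opprB sinN cosN sinBpihalf cosBpihalf.
by rewrite opprK powR_inv1// ltW// sin_gt0_pi.
Qed.

Lemma atan_lt (x y : R) : (atan x < atan y)%R = (x < y)%R.
Proof. exact: (leW_mono (le_mono (@lt_atan R))). Qed.

Lemma cot_preimage (a b : R) :
  cot @^-1` `]a, b] `&` `]0%R, pi[ =
  `[(pi / 2 - atan b)%R, (pi / 2 - atan a)%R[%classic.
Proof.
have H x : (0 < x < pi)%R ->
    ((a < cot x <= b) = (pi / 2 - atan b <= x < pi / 2 - atan a))%R.
  move=> x0pi; rewrite cotE//; set y := (pi / 2 - x)%R.
  have yE : atan (tan y) = y.
    apply: tanK; rewrite in_itv/= /y; case/andP: x0pi => x0 xpi.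
    by apply/andP; split; lra.
  rewrite -atan_lt -(le_mono (@lt_atan R)) yE /y.
  by rewrite andbC ltrBrDl lerBlDl -ltrBrDr -lerBlDr; congr andb; lra.
apply/seteqP; split=> x /=; rewrite !in_itv /=.
  by move=> [+ x0pi]; rewrite H.
move=> xab; have x0pi : (0 < x < pi)%R.
  have := atan_ltpi2 b; have := atan_gtNpi2 a.
  by case/andP: xab => *; apply/andP; split; lra.
by rewrite H.
Qed.

(** The substitution b = cot theta for Borel functions: both sides are integrals
    against measures that give ]a, b] the mass atan b - atan a. *)
Lemma integral_cot (K : mR -> \bar R) : nnmeas K ->
  \int[lambda]_(x in `]0%R, pi[) K (cot x) =
  \int[lambda]_x (K x * ((1 + x ^+ 2)^-1)%:E).
Proof.
move=> KP.
have w0 (x : mR) : (0 <= (1 + x ^+ 2)^-1 :> R)%R.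
  by rewrite invr_ge0 addr_ge0// sqr_ge0.
have mw : measurable_fun setT (fun x : mR => (1 + x ^+ 2)^-1 : R)%R.
  exact: continuous_measurable_fun continuous_cauchy_density.
rewrite -(integral_density w0 mw KP).
have KcP := nnmeas_comp KP measurable_cot.
transitivity (\int[mrestr lambda (measurable_itv `]0%R, pi[)]_x (K \o cot) x).
  by rewrite integral_mrestr.
rewrite /comp -(integral_push _ measurable_cot KP).
have E (a b : R) : (a < b)%R -> density mw `]a, b]%classic = (atan b - atan a)%:E.
  move=> ab; rewrite -integral_cauchy_density// -[LHS]mul1e.
  rewrite -[LHS](integral_cst (density mw))// integral_mkcond.
  rewrite integral_density//; last first.
    split.
      apply: (measurable_restrictT _ (measurable_itv `]a, b])).1.
      exact: measurable_cst.
    by move=> x; apply: erestrict_ge0.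
  rewrite [RHS]integral_mkcond; apply: eq_integral => x _; rewrite !patchE.
  by case: ifP; rewrite ?mul1e ?mul0e.
apply: eq_measure_integral => A mA _; apply/esym.
apply: (@measure_unique _ R mR (@ocitv R)
  (fun n => `](- n%:R)%R, (n%:R : R)%R]%classic)) => //.
- exact: ocitvI.
- by move=> n; exact: is_ocitv.
- exact: bigcup_itvT.
- move=> X /ocitvP[->|[[a b] /= ab ->]]; first by rewrite !measure0.
  rewrite E//= /pushforward /mrestr cot_preimage lebesgue_measure_itv/= lte_fin.
  by rewrite ltrD2l ltrN2 atan_lt ab -EFinB; congr EFin; ring.
- move=> n; case: (ltP (- n%:R)%R (n%:R : R)%R) => nn; first by rewrite E// ltry.
  by rewrite set_itv_ge ?measure0// bnd_simp -leNgt.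
Qed.

End change_of_variables.

(** * Integrals over the lines of given slope and the Radon transform *)

Section slope_transform.
Context {R : realType}.
Local Notation mR := (measurableTypeR R).
Local Notation lambda := (@lebesgue_measure R).

(** Tonelli's theorem on the product of the circle and the line asks for a
    sigma-finite measure on the circle. *)
Lemma arc_length_sigma_finite : sigma_finite setT (@arc_length R).
Proof.
exists (fun=> setT); first by rewrite bigcup_const.
move=> _; split => //; rewrite /arc_length /pushforward preimage_setT /mrestr setTI.
rewrite lebesgue_measure_itv/=; case: ifP => // _.
by rewrite -EFinB ltry.
Qed.

HB.instance Definition _ :=
  Measure_isSigmaFinite.Build _ _ _ (@arc_length R) arc_length_sigma_finite.

(** The integral over the line {(a, s - b a)} at the point (b, s). It is a Radon
    transform in which the lines are parametrized by slope and intercept, and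
    the points of a line by their abscissa. *)
Definition slope_int (g : mR * mR -> \bar R) (p : mR * mR) : \bar R :=
  \int[lambda]_a g (a, p.2 - p.1 * a)%R.

Lemma measurable_shear : measurable_fun setT
  (fun p : (mR * mR) * mR => (p.2, p.1.2 - p.1.1 * p.2)%R : mR * mR).
Proof.
apply: measurable_fun_pair; first exact: measurable_snd.
apply: measurable_funB.
  exact: (measurableT_comp measurable_snd measurable_fst).
apply: measurable_funM; last exact: measurable_snd.
exact: (measurableT_comp measurable_fst measurable_fst).
Qed.

Lemma nnmeas_slope_int g : nnmeas g -> nnmeas (slope_int g).
Proof. by move=> gP; exact: (nnmeas_int lambda (nnmeas_comp gP measurable_shear)). Qed.

Lemma nnmeas_section (g : mR * mR -> \bar R) (b : mR) :
  nnmeas g -> nnmeas (fun s : mR => g (b, s)).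
Proof. by move=> gP; exact: (nnmeas_comp gP (measurable_pair1 b)). Qed.

Lemma tonelli (g : mR * mR -> \bar R) : nnmeas g ->
  \int[lambda \x lambda]_p g p = \int[lambda]_x \int[lambda]_y g (x, y).
Proof. by move=> [mg g0]; rewrite fubini_tonelli1. Qed.

Lemma tonelliC (g : mR * mR -> \bar R) : nnmeas g ->
  \int[lambda]_x \int[lambda]_y g (x, y) = \int[lambda]_y \int[lambda]_x g (x, y).
Proof. by move=> [mg g0]; rewrite (fubini_tonelli g mg g0). Qed.

(** The lines of a given slope foliate the plane. *)
Lemma integral_slope_int (g : mR * mR -> \bar R) (b : mR) : nnmeas g ->
  \int[lambda]_s slope_int g (b, s) = \int[lambda \x lambda]_p g p.
Proof.
move=> gP; rewrite (tonelli gP) /slope_int /=.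
have hP : nnmeas (fun p : mR * mR => g (p.2, p.1 - b * p.2)%R).
  apply: (nnmeas_comp gP); apply: measurable_fun_pair; first exact: measurable_snd.
  apply: measurable_funB; first exact: measurable_fst.
  by apply: measurable_funM => //; exact: measurable_snd.
rewrite (tonelliC hP); apply: eq_integral => a _ /=.
exact: (integral_translate (- (b * a))%R (nnmeas_section a gP)).
Qed.

Lemma ae0_slope_int g : nnmeas g -> \int[lambda \x lambda]_p g p = 0 ->
  ae_eq (lambda \x lambda) setT (slope_int g) (cst 0).
Proof.
move=> gP g0; have [mT T0] := nnmeas_slope_int gP.
apply: integral_eq0_ae => //; rewrite tonelli//.
by under eq_integral do rewrite integral_slope_int// g0; rewrite integral0.
Qed.

Section radon_slope.
Variable f : mR * mR -> R.
Hypothesis mf : measurable_fun setT f.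
Hypothesis f0 : forall x, (0 <= f x)%R.

Let fP : nnmeas (EFin \o f).
Proof. by split; [exact/measurable_EFinP|move=> x; rewrite lee_fin]. Qed.

Lemma radon_ge0 p : 0 <= radon f p.
Proof. by case: p => -[s1 s2] s; apply: integral_ge0 => r _; rewrite lee_fin. Qed.

Lemma nnmeas_radon : nnmeas (radon f).
Proof.
split; last exact: radon_ge0.
pose h (q : ((mR * mR) * mR) * mR) : mR * mR :=
  (q.1.2 * q.1.1.1 - q.2 * q.1.1.2, q.1.2 * q.1.1.2 + q.2 * q.1.1.1)%R.
have mh : measurable_fun setT h.
  have m1 : measurable_fun setT (fun q : ((mR * mR) * mR) * mR => q.1.1.1).
    apply: (measurableT_comp measurable_fst).
    exact: (measurableT_comp measurable_fst measurable_fst).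
  have m2 : measurable_fun setT (fun q : ((mR * mR) * mR) * mR => q.1.1.2).
    apply: (measurableT_comp measurable_snd).
    exact: (measurableT_comp measurable_fst measurable_fst).
  have m3 : measurable_fun setT (fun q : ((mR * mR) * mR) * mR => q.1.2).
    exact: (measurableT_comp measurable_snd measurable_fst).
  have m4 : measurable_fun setT (fun q : ((mR * mR) * mR) * mR => q.2).
    exact: measurable_snd.
  by apply: measurable_fun_pair;
    [apply: measurable_funB|apply: measurable_funD]; exact: measurable_funM.
have := (nnmeas_int lambda (nnmeas_comp fP mh)).1.
apply: eq_measurable_fun => -[[s1 s2] s] _ //.
Qed.

(** sin theta as a function of b = cot theta. *)
Definition rho (b : mR) : R := Num.sqrt (1 + b ^+ 2)^-1.

Lemma rho_gt0 b : (0 < rho b)%R.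
Proof. by rewrite sqrtr_gt0 invr_gt0 ltr_pwDl// sqr_ge0. Qed.

Lemma rho_sqr b : (rho b ^+ 2 = (1 + b ^+ 2)^-1)%R.
Proof. by rewrite sqr_sqrtr// invr_ge0 addr_ge0// sqr_ge0. Qed.

(** The abscissa a = s cos theta - r sin theta on the line is an affine function
    of the arc length r, with the factor - sin theta, where b = cot theta. *)
Lemma radon_slope (b s : mR) :
  (rho b)%:E * radon f ((b * rho b, rho b)%R, s) =
  slope_int (EFin \o f) (b, s / rho b)%R.
Proof.
have r0 := rho_gt0 b; rewrite /slope_int /radon /=.
pose phi (a : mR) := (EFin \o f) (a, s / rho b - b * a)%R.
have phiP : nnmeas phi.
  apply: (nnmeas_comp fP); apply: measurable_fun_pair => //.
  by apply: measurable_funB => //; exact: measurable_funM.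
rewrite -[RHS](@integral_affine _ (- rho b)%R (s * (b * rho b))%R _ _ phiP); last first.
  by rewrite oppr_eq0 gt_eqF.
rewrite /= normrN gtr0_norm//; congr (_ * _); apply: eq_integral => r _.
rewrite /phi /=; congr (f (_, _))%:E; first by rewrite mulNr [RHS]addrC (mulrC r).
have E : (1 = rho b ^+ 2 * (1 + b ^+ 2))%R.
  by rewrite rho_sqr mulVf// gt_eqF// ltr_pwDl// sqr_ge0.
have -> : (s / rho b = s * (rho b * (1 + b ^+ 2)))%R.
  by apply: (mulIf (lt0r_neq0 r0)); rewrite divfK ?gt_eqF// -[LHS]mulr1 {1}E; ring.
ring.
Qed.
End radon_slope.
End slope_transform.

Section radon_bound.
Context {R : realType}.
Local Notation mR := (measurableTypeR R).
Local Notation lambda := (@lebesgue_measure R).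

Lemma measurable_rho : measurable_fun setT (@rho R : mR -> mR).
Proof.
apply: continuous_measurable_fun => x.
apply: (@continuous_comp _ _ _ (fun b : R => (1 + b ^+ 2)^-1)%R).
  exact: continuous_cauchy_density.
exact: sqrt_continuous.
Qed.

Lemma rho_cot (x : R) : (0 < x < pi)%R -> rho (cot x) = sin x.
Proof.
move=> x0pi; have s0 := sin_gt0_pi x0pi.
have E : ((1 + cot x ^+ 2)^-1 = sin x ^+ 2)%R.
  rewrite /cot powR_inv1 ?ltW// exprMn exprVn.
  have -> : (1 + cos x ^+ 2 / sin x ^+ 2 = (sin x ^+ 2)^-1)%R.
    have sn0 : sin x != 0%R by rewrite gt_eqF.
    by rewrite -[in RHS]div1r -[in RHS](cos2Dsin2 x); field.
  by rewrite invrK.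
by rewrite /rho E sqrtr_sqr gtr0_norm.
Qed.

Lemma cot_rho (x : R) : (0 < x < pi)%R -> (cot x * rho (cot x) = cos x)%R.
Proof.
move=> x0pi; have s0 := sin_gt0_pi x0pi.
by rewrite rho_cot// /cot powR_inv1 ?ltW// divfK// gt_eqF.
Qed.

(** Every real b is cot theta for exactly one theta in ]0, pi[. With q = sin
    theta, the transforms are related by q * radon = slope_int (_ / q), so that
    the cube contributes q ^ (-3), the change of s contributes q, and the
    remaining q ^ (-2) is cancelled by d theta = q ^ 2 d b. The inequality comes
    from the other half of the circle. *)
Lemma slope_int_radon (f : mR * mR -> R) : measurable_fun setT f ->
  (forall x, 0 <= f x)%R ->
  \int[lambda \x lambda]_p slope_int (EFin \o f) p `^ 3 <=
  'N[arc_length \x lambda]_3%:E [radon f] `^ 3.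
Proof.
move=> mf f0; have fP : nnmeas (EFin \o f).
  by split; [exact/measurable_EFinP|move=> x; rewrite lee_fin].
have RP := nnmeas_radon mf f0; have R3P := nnmeas_poweR 3 RP.
have TP := nnmeas_slope_int fP; have T3P := nnmeas_poweR 3 TP.
rewrite poweR_Lnorm//.
under [leRHS]eq_integral do rewrite gee0_abs ?radon_ge0//.
rewrite (fubini_tonelli1 _ R3P.1 R3P.2) /fubini_F.
pose Q p := \int[lambda]_s radon f (p, s) `^ 3.
have QP : nnmeas Q by exact: (nnmeas_int lambda R3P).
rewrite [leRHS](_ : _ = \int[lambda]_(x in `[0%R, (2 * pi)%R[) Q (circle_param x));
  last first.
  have QcP := nnmeas_comp QP measurable_circle_param.
  transitivity (\int[mrestr lambda (measurable_itv `[0%R, (2 * pi)%R[)]_x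
      (Q \o circle_param) x); last by rewrite integral_mrestr.
  exact: (integral_push _ measurable_circle_param QP).
pose K b := Q (b * rho b, rho b)%R.
have mK : measurable_fun setT (fun b : mR => (b * rho b, rho b)%R : mR * mR).
  apply: measurable_fun_pair; last exact: measurable_rho.
  by apply: measurable_funM => //; exact: measurable_rho.
have KP : nnmeas K by exact: (nnmeas_comp QP mK).
apply: (@le_trans _ _ (\int[lambda]_(x in `]0%R, pi[) Q (circle_param x))); last first.
  apply: ge0_subset_integral => //.
  - apply: measurable_funTS; exact: (measurableT_comp QP.1 measurable_circle_param).
  - by move=> x _; exact: QP.2.
  - move=> x /=; rewrite !in_itv /= => /andP[x0 xpi]; rewrite ltW//=.
    by rewrite (lt_trans xpi)// ltr_pMl ?pi_gt0// ltr1n.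
rewrite [leRHS](_ : _ = \int[lambda]_(x in `]0%R, pi[) K (cot x)); last first.
  apply: eq_integral => x; rewrite inE/= in_itv/= => x0pi.
  by rewrite /K (cot_rho x0pi) (rho_cot x0pi).
rewrite (integral_cot KP) (tonelli T3P); apply: eq_lee.
apply: eq_integral => b _.
have r0 := rho_gt0 b; have T3bP := nnmeas_section b T3P.
rewrite -rho_sqr muleC.
have rV0 : (0 < (rho b)^-1)%R by rewrite invr_gt0.
have mS : measurable_fun setT (fun s : mR => (rho b)^-1 * s : mR)%R.
  exact: measurable_funM.
rewrite -(integral_scale_pos rV0 T3bP) /K /Q.
have rV0' : 0 <= (rho b)^-1%:E by rewrite lee_fin ltW.
have r20 : 0 <= (rho b ^+ 2)%:E by rewrite lee_fin sqr_ge0.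
have R3bP := nnmeas_comp R3P (measurable_pair1 (b * rho b, rho b)%R).
rewrite -(nnmeas_integralZl lambda (nnmeas_comp T3bP mS) rV0').
rewrite -(nnmeas_integralZl lambda R3bP r20).
apply: eq_integral => s _; rewrite /= [((rho b)^-1 * s)%R]mulrC -radon_slope//.
rewrite poweRM ?lee_fin ?(ltW r0) ?radon_ge0// muleA; congr (_ * _).
rewrite poweR_EFin -EFinM; congr EFin.
rewrite powR_mulrn ?ltW// ; field; exact: lt0r_neq0.
Qed.

End radon_bound.

Section slope_bound.
Context {R : realType}.
Local Notation mR := (measurableTypeR R).
Local Notation lambda := (@lebesgue_measure R).
Local Notation radonN := (radon_norm (3 / 2 : R) 3).

Lemma radon_norm_ge (f : mR * mR -> R) : measurable_fun setT f ->
  (forall x, 0 <= f x)%R ->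
  \int[lambda \x lambda]_p ((f p)%:E `^ (3 / 2)) <= 1 ->
  (\int[lambda \x lambda]_p slope_int (EFin \o f) p `^ 3) `^ 3^-1 <= radonN.
Proof.
move=> mf f0 f1.
apply: (@le_trans _ _ ('N[arc_length \x lambda]_3%:E [radon f])).
  rewrite -[leRHS](@poweRVK _ _ 3) ?Lnorm_ge0//.
  apply: ge0_le_poweR; rewrite ?invr_ge0//; last exact: slope_int_radon.
  by apply: integral_ge0 => x _; exact: poweR_ge0.
apply: ereal_sup_ubound; exists f => //; split=> //.
rewrite unlock /Lnorm -(@poweR1r R (3 / 2)^-1).
apply: ge0_le_poweR; first by rewrite invr_ge0.
  by apply: integral_ge0 => x _; exact: poweR_ge0.
apply: le_trans f1; apply: eq_lee.
by apply: eq_integral => x _; rewrite gee0_abs// lee_fin.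
Qed.

Lemma radonN_ge0 : 0 <= radonN.
Proof.
apply: le_trans (@radon_norm_ge (cst 0%R) _ _ _) => //.
- exact: poweR_ge0.
- rewrite (eq_integral (cst 0)); first by rewrite integral0.
  by move=> x _; rewrite poweR_EFin powR0.
Qed.

(** The indicator function of the unit square has a transform that is not almost
    everywhere zero, since the integral of the transform over s is 1 for every
    slope. *)
Lemma radonN_gt0 : 0 < radonN.
Proof.
rewrite lt0e radonN_ge0 andbT; apply/negP => /eqP G0.
pose I : set mR := `[0%R, 1%R]%classic; pose A : set (mR * mR) := I `*` I.
have mI : measurable I by exact: measurable_itv.
have mA : measurable A by exact: measurableX.
have lI : lambda I = 1.
  by rewrite /I lebesgue_measure_itv/= lte_fin ltr01 oppr0 adde0.
have lA : (lambda \x lambda)%E A = 1.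
  transitivity (lambda I * lambda I); first exact: product_measure1E.
  by rewrite lI mule1.
pose f : mR * mR -> R := \1_A.
have f0 x : (0 <= f x)%R by [].
have mf : measurable_fun setT f by exact: measurable_indic.
have fP : nnmeas (EFin \o f) by split=> //; exact/measurable_EFinP.
have If : \int[lambda \x lambda]_p (EFin \o f) p = 1.
  by rewrite -[RHS]lA /= integral_indic// setIT.
have := @radon_norm_ge f mf f0 _; rewrite G0.
have -> : \int[lambda \x lambda]_p (f p)%:E `^ (3 / 2) = 1.
  rewrite -[RHS]If; apply: eq_integral => p _; rewrite /= /f indicE.
  by case: (_ \in _); rewrite ?powR1 ?powR0.
move=> /(_ (lexx _)); have TP := nnmeas_slope_int fP; have T3P := nnmeas_poweR 3 TP.
rewrite le_eqVlt ltNge poweR_ge0 orbF => /eqP.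
move=> /poweR_eq0_eq0 => /(_ (integral_ge0 _ (fun x _ => T3P.2 x))) H0.
have T0 : \int[lambda \x lambda]_p slope_int (EFin \o f) p = 0.
  apply: ae_eq0_integral; first exact: TP.1.
  apply: filterS (integral_eq0_ae T3P.1 T3P.2 H0) => x /= /(_ Logic.I) + _.
  by move/poweR_eq0_eq0 => ->//; exact: TP.2.
have : \int[lambda]_b (cst 1) b = 0.
  rewrite -[RHS]T0 (tonelli TP); apply: eq_integral => b _.
  by rewrite (integral_slope_int b fP) If.
rewrite integral_cst// mul1e.
move=> lT; suff : (+oo : \bar R) = 0 by [].
rewrite -lT; have <- : lambda [set` `]-oo, +oo[%R] = +oo.
  by rewrite lebesgue_measure_itv.
by rewrite set_itvNyy.
Qed.

Lemma slope_intD (g h : mR * mR -> \bar R) p : nnmeas g -> nnmeas h ->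
  slope_int (fun x => g x + h x) p = slope_int g p + slope_int h p.
Proof.
move=> gP hP; have ms := measurableT_comp measurable_shear (measurable_pair1 p).
have [mg g0] := nnmeas_comp gP ms; have [mh h0] := nnmeas_comp hP ms.
exact: (ge0_integralD lambda measurableT (fun x _ => g0 x) mg (fun x _ => h0 x) mh).
Qed.

Lemma slope_intZ (g : mR * mR -> \bar R) k p : nnmeas g -> 0 <= k ->
  slope_int (fun x => k * g x) p = k * slope_int g p.
Proof.
move=> gP k0; have ms := measurableT_comp measurable_shear (measurable_pair1 p).
exact: (nnmeas_integralZl lambda (nnmeas_comp gP ms) k0).
Qed.

(** By homogeneity it suffices to treat functions of norm 1. The Radon norm only
    tests finite functions, and g may take the value infinity on a null set:
    this changes slope_int on a null set only. The two degenerate cases are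
    separate: if the norm of g is 0 then slope_int g is 0 almost everywhere, and
    if it is infinite then the right-hand side is infinite, as the Radon norm is
    positive. *)
Lemma slope_int_bound (g : mR * mR -> \bar R) : nnmeas g ->
  (\int[lambda \x lambda]_p slope_int g p `^ 3) `^ 3^-1 <=
  radonN * (\int[lambda \x lambda]_p g p `^ (3 / 2)) `^ (2 / 3).
Proof.
move=> gP; have TP := nnmeas_slope_int gP; have T3P := nnmeas_poweR 3 TP.
have gpP := nnmeas_poweR (3 / 2) gP.
set I := \int[_]_p (g p `^ _).
have I0 : 0 <= I by apply: integral_ge0 => x _; exact: gpP.2.
have p0 : (3 / 2 : R)%R != 0%R by [].
have [II0|In0] := eqVneq I 0.
  rewrite II0 poweR0r// mule0.
  have g00 : \int[lambda \x lambda]_p g p = 0.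
    apply: ae_eq0_integral; first exact: gP.1.
    apply: filterS (integral_eq0_ae gpP.1 gpP.2 II0) => x /= /(_ Logic.I) + _.
    by move/poweR_eq0_eq0 => ->//; exact: gP.2.
  rewrite ae_eq0_integral ?poweR0r//; first exact: T3P.1.
  apply: filterS (ae0_slope_int gP g00) => x /= /(_ Logic.I) -> _.
  by rewrite poweR0r.
have [->|Iy] := eqVneq I +oo.
  by rewrite poweRyr// gt0_muley ?leey// radonN_gt0.
have Ifin : I \is a fin_num by rewrite ge0_fin_numE// ltey.
pose c := (fine I `^ (2 / 3))%R.
have cE : I `^ (2 / 3) = c%:E by rewrite -[I]fineK.
have c0 : (0 < c)%R by rewrite powR_gt0// fine_gt0// lt0e In0 I0 ltey.
pose f0 p := fine (g p).
pose f p := (c^-1 * f0 p)%R.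
have mf0 : measurable_fun setT f0 by apply: measurableT_comp gP.1.
have mf : measurable_fun setT f by exact: measurable_funM.
have f0_ge0 p : (0 <= f0 p)%R by rewrite fine_ge0// gP.2.
have f_ge0 p : (0 <= f p)%R by rewrite mulr_ge0// invr_ge0 ltW.
have f0P : nnmeas (EFin \o f0) by split=> [|x];
  [exact/measurable_EFinP|rewrite lee_fin].
have fP : nnmeas (EFin \o f) by split=> [|x]; [exact/measurable_EFinP|rewrite lee_fin].
have cV0 : 0 <= c^-1%:E by rewrite lee_fin invr_ge0 ltW.
have ffin : {ae lambda \x lambda, forall x, setT x -> g x = (f0 x)%:E}.
  have /(integrable_ae measurableT) : (lambda \x lambda).-integrable setT
      (fun p => g p `^ (3 / 2)).
    apply/integrableP; split; first exact: gpP.1.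
    under eq_integral do rewrite gee0_abs ?poweR_ge0//.
    by rewrite ltey.
  apply: filterS => x /= /(_ Logic.I) gx _; rewrite /f0 fineK//.
  by rewrite ge0_fin_numE ?gP.2// (lty_poweRy p0)// ltey_eq gx.
have f1 : \int[lambda \x lambda]_p ((f p)%:E `^ (3 / 2)) <= 1.
  have -> : \int[lambda \x lambda]_p ((f p)%:E `^ (3 / 2)) =
      \int[lambda \x lambda]_p ((c^-1)%:E `^ (3 / 2) * g p `^ (3 / 2)).
    apply: ge0_ae_eq_integral => //.
    - by apply: measurable_fun_poweR; exact/measurable_EFinP.
    - by apply: measurable_funeM; exact: gpP.1.
    - by move=> x _; exact: poweR_ge0.
    - by move=> x _; rewrite mule_ge0// poweR_ge0.
    - apply: filterS ffin => x /= /(_ Logic.I) gx _.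
      by rewrite gx /= -EFinM -powRM ?invr_ge0 ?(ltW c0) ?f0_ge0.
  rewrite (nnmeas_integralZl _ gpP) ?poweR_ge0// -/I -[I]fineK//.
  rewrite poweR_EFin -EFinM lee_fin /c -powR_inv1 ?powR_ge0// -!powRrM.
  rewrite (_ : (2 / 3 * (-1 * (3 / 2)))%R = (-1)%R); last by field.
  by rewrite powR_inv1 ?fine_ge0// mulVf// fine_eq0.
have := radon_norm_ge mf f_ge0 f1.
have T0P := nnmeas_slope_int f0P.
have -> : \int[lambda \x lambda]_p slope_int g p `^ 3 =
    \int[lambda \x lambda]_p slope_int (EFin \o f0) p `^ 3.
  pose h p := g p - (f0 p)%:E.
  have gE p : g p = (f0 p)%:E + h p.
    rewrite /h /f0; have := gP.2 p; case: (g p) => [r|//|//] _ /=.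
      by rewrite subee// adde0.
  have hP : nnmeas h.
    split; first by apply: emeasurable_funB; [exact: gP.1|exact: f0P.1].
    move=> p; rewrite /h /f0; have := gP.2 p; case: (g p) => [r|//|//] _ /=.
    by rewrite subee.
  have h0 : \int[lambda \x lambda]_p h p = 0.
    apply: ae_eq0_integral; first exact: hP.1.
    by apply: filterS ffin => x /= /(_ Logic.I) gx _; rewrite /h gx subee.
  apply: ge0_ae_eq_integral => //.
  - exact: T3P.1.
  - exact: (nnmeas_poweR 3 T0P).1.
  - by move=> x _; exact: poweR_ge0.
  - by move=> x _; exact: poweR_ge0.
  - apply: filterS (ae0_slope_int hP h0) => p /= /(_ Logic.I) hp _.
    rewrite (_ : g = fun p => (EFin \o f0) p + h p); last first.
      by apply/funext => q; rewrite gE.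
    by rewrite slope_intD// hp adde0.
have TfE p : slope_int (EFin \o f) p = c^-1%:E * slope_int (EFin \o f0) p.
  by rewrite -slope_intZ.
under eq_integral do rewrite TfE poweRM ?(T0P.2 _)//.
rewrite (nnmeas_integralZl _ (nnmeas_poweR 3 T0P)) ?poweR_ge0//.
rewrite poweRM ?poweR_ge0//; last by apply: integral_ge0 => x _; exact: poweR_ge0.
rewrite poweRVK// => H.
have cc0 : 0 <= c%:E by rewrite lee_fin ltW.
have := lee_wpmul2l cc0 H; rewrite muleA -EFinM divff ?gt_eqF// mul1e.
by rewrite -cE muleC.
Qed.

End slope_bound.

(** * The Heisenberg group *)

Section heisenberg.
Context {R : realType}.
Local Notation mR := (measurableTypeR R).
Local Notation lambda := (@lebesgue_measure R).
Local Notation radonN := (radon_norm (3 / 2 : R) 3).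

(** Translating t by c a b, the variable a occurs in the second factor only,
    through an integral over a line of slope -2cb; Hoelder with exponents 3/2
    and 3 and [slope_int_bound] conclude. The factor (2c)^(-1/3) comes from the
    dilation of b by 2c. *)
Lemma heisenberg_bound (c : R) (Phi Psi : mR * mR -> \bar R) :
  (0 < c)%R -> nnmeas Phi -> nnmeas Psi ->
  \int[lambda]_a \int[lambda]_b \int[lambda]_t
    (Phi (b, t + c * a * b)%R * Psi (a, t - c * a * b)%R) `^ (2 / 3) <=
  ((2 * c) `^ (- 3^-1))%:E * radonN *
    (\int[lambda \x lambda]_p Phi p * \int[lambda \x lambda]_p Psi p) `^ (2 / 3).
Proof.
move=> c0 PhiP PsiP.
have c20 : (0 < 2 * c)%R by rewrite mulr_gt0.
pose g p := Psi p `^ (2 / 3); have gP : nnmeas g by exact: nnmeas_poweR.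
have TP := nnmeas_slope_int gP.
have msc : measurable_fun setT (fun p : mR * mR => (2 * c * p.1, p.2)%R : mR * mR).
  apply: measurable_fun_pair; last exact: measurable_snd.
  by apply: measurable_funM => //; exact: measurable_fst.
pose G (p : mR * mR) := slope_int g (2 * c * p.1, p.2)%R `^ 3.
have GP : nnmeas G by exact: (nnmeas_comp (nnmeas_poweR 3 TP) msc).
pose H (q : (mR * mR) * mR) := Phi (q.1.2, q.2) `^ (2 / 3) *
  g (q.1.1, q.2 - 2 * c * q.1.2 * q.1.1)%R.
have m1 : measurable_fun setT (fun q : (mR * mR) * mR => q.1.1).
  exact: (measurableT_comp measurable_fst measurable_fst).
have m2 : measurable_fun setT (fun q : (mR * mR) * mR => q.1.2).
  exact: (measurableT_comp measurable_snd measurable_fst).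
have HP : nnmeas H.
  apply: nnmeasM.
    apply: (nnmeas_comp (nnmeas_poweR (2 / 3) PhiP)).
    by apply: measurable_fun_pair => //; exact: measurable_snd.
  apply: (nnmeas_comp gP); apply: measurable_fun_pair => //.
  apply: measurable_funB; first exact: measurable_snd.
  by apply: measurable_funM => //; exact: measurable_funM.
have E1 a b : \int[lambda]_t
    (Phi (b, t + c * a * b)%R * Psi (a, t - c * a * b)%R) `^ (2 / 3) =
    \int[lambda]_t H ((a, b), t).
  rewrite -(integral_translate (c * a * b)%R
    (nnmeas_comp HP (measurable_pair1 (a, b)))).
  apply: eq_integral => t _; rewrite /H /g /= -poweRM ?PhiP.2 ?PsiP.2//.
  by congr ((_ * Psi (_, _)) `^ _); ring.
under eq_integral do under eq_integral do rewrite E1.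
rewrite (tonelliC (nnmeas_int lambda HP)).
have E2 b : \int[lambda]_a \int[lambda]_t H ((a, b), t) =
    \int[lambda]_t (Phi (b, t) `^ (2 / 3) * G (b, t) `^ 3^-1).
  have mab : measurable_fun setT (fun p : mR * mR => ((p.1, b), p.2) : (mR * mR) * mR).
    by apply: measurable_fun_pair; [apply: measurable_fun_pair|exact: measurable_snd];
      [exact: measurable_fst|].
  rewrite (tonelliC (nnmeas_comp HP mab)) /=; apply: eq_integral => t _.
  have gsP : nnmeas (fun a : mR => g (a, t - 2 * c * b * a)%R).
    exact: (nnmeas_comp gP (measurableT_comp measurable_shear
      (measurable_pair1 (2 * c * b, t)%R))).
  rewrite /H /= (nnmeas_integralZl lambda gsP) ?poweR_ge0//.
  by rewrite /G poweRVK ?TP.2.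
under eq_integral do rewrite E2.
have KP : nnmeas (fun p => Phi p `^ (2 / 3) * G p `^ 3^-1).
  by apply: nnmeasM; exact: nnmeas_poweR.
rewrite -(tonelli KP).
apply: le_trans (hoelder2_poweR (lambda \x lambda) PhiP.1 GP.1 PhiP.2 GP.2 _ _ _) _.
- by [].
- by rewrite invr_ge0.
- by field.
have G3 : \int[lambda \x lambda]_p G p =
    ((2 * c)^-1)%:E * \int[lambda \x lambda]_p slope_int g p `^ 3.
  rewrite (tonelli GP) (tonelli (nnmeas_poweR 3 TP)).
  have /= <- := integral_scale_pos c20 (nnmeas_int lambda (nnmeas_poweR 3 TP)).
  by rewrite muleA -EFinM mulVf ?gt_eqF// mul1e.
have I0 (f : mR * mR -> \bar R) : nnmeas f -> 0 <= \int[lambda \x lambda]_p f p.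
  by move=> fP; apply: integral_ge0 => x _; exact: fP.2.
have c2V : 0 <= ((2 * c)^-1)%:E by rewrite lee_fin invr_ge0 ltW.
rewrite G3 poweRM ?I0//; last exact: nnmeas_poweR.
rewrite [leRHS]muleC (poweRM _ (I0 _ PhiP) (I0 _ PsiP)) -!muleA.
apply: lee_wpmul2l; first exact: poweR_ge0.
rewrite [leRHS]muleC -muleA.
have -> : ((2 * c)^-1)%:E `^ 3^-1 = ((2 * c) `^ (- 3^-1))%:E.
  by rewrite poweR_EFin -powR_inv1 ?(ltW c20)// -powRrM mulN1r.
apply: lee_wpmul2l; first by rewrite lee_fin powR_ge0.
apply: le_trans (slope_int_bound gP) _; apply: lee_wpmul2l; first exact: radonN_ge0.
apply: eq_lee; congr (_ `^ _).
apply: eq_integral => p _; rewrite /g -poweRrM.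
by rewrite (_ : (2 / 3 * (3 / 2) = 1)%R) ?poweRe1 ?PsiP.2//; field.
Qed.

End heisenberg.

(** * One distinguished pair of coordinates *)

Section one_pair.
Context {R : realType}.
Local Notation mR := (measurableTypeR R).
Local Notation lambda := (@lebesgue_measure R).
Local Notation radonN := (radon_norm (3 / 2 : R) 3).

(** Here h k x is the height added to t in the k-th projection; it is arbitrary
    except for the distinguished pair u, v. *)
Section pair.
Variables (m : nat) (h : 'I_m -> m.-tuple mR -> R) (u v : 'I_m) (c : R).
Hypothesis mh : forall k, measurable_fun setT (h k).
Hypothesis uv : u != v.
Hypothesis c0 : (0 < c)%R.
Hypothesis hu : forall x, h u x = (c * tnth x u * tnth x v)%R.
Hypothesis hv : forall x, h v x = (- (c * tnth x u * tnth x v))%R.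
Variable F : 'I_m -> m.-tuple mR -> \bar R.
Hypothesis FP : forall k, nnmeas (F k).

Let N : R := m.+1%:R.
Let w (k : 'I_m) : R := ((if (k == u) || (k == v) then 2 else 1) / N)%R.
(** The weights of Hoelder's inequality on the space of the three variables u, v
    and t, where the functions of the pair are merged into one factor of weight
    3/N, at the index u. *)
Let w' (k : 'I_m) : R := ((if k == u then 3 else 1) / N)%R.
Let A := ((2 * c) `^ (- 3^-1))%:E * radonN.
Let G k (p : m.-tuple mR * mR) := F k (hat k p.1 (p.2 + h k p.1)%R).
Let P k x := \int[lambda]_s F k (hat k x s).
(** The integrals in t of the factors of this application of Hoelder's
    inequality. *)
Let T k x := \int[lambda]_t
  (if k == u then (G u (x, t) * G v (x, t)) `^ (2 / 3) else G k (x, t)).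
Let rest := [seq i <- enum 'I_m | (i != u) && (i != v)].
(** The k-th function after the integration of t, u and v. *)
Let Q k := if k == u then coord_int v (P u) else if k == v then coord_int u (P v)
  else coord_int u (coord_int v (P k)).

Let N0 : (0 < N)%R. Proof. by rewrite ltr0n. Qed.

Let w_ge0 k : (0 <= w k)%R.
Proof. by rewrite /w divr_ge0 ?(ltW N0)//; case: ifP. Qed.

Let w'_ge0 k : (0 <= w' k)%R.
Proof. by rewrite /w' divr_ge0 ?(ltW N0)//; case: ifP. Qed.

Let sum_delta (j : 'I_m) : (\sum_(k < m) (k == j)%:R = 1 :> R)%R.
Proof.
rewrite (bigD1 j)//= eqxx big1 ?addr0// => k /negbTE ->.
by [].
Qed.

Let sum_w' : (\sum_(k | k != v) w' k = 1)%R.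
Proof.
have S : (\sum_k w' k = (m%:R + 2) / N)%R.
  rewrite /w' -mulr_suml; congr (_ / _)%R.
  rewrite (eq_bigr (fun k : 'I_m => 1 + (k == u)%:R * 2)%R); last first.
    by move=> k _; case: ifP => _ /=; ring.
  by rewrite big_split/= sumr_const card_ord -mulr_suml sum_delta mul1r.
have := S; rewrite (bigD1 v)//= {1}/w' eq_sym (negbTE uv).
have -> : N = (m%:R + 1)%R by rewrite /N -natr1.
move=> /(canRL (addKr _)) ->; field.
by rewrite natr1 pnatr_eq0.
Qed.

Let sum_w i : i \in rest -> (\sum_(k | k != i) w k = 1)%R.
Proof.
rewrite mem_filter => /andP[/andP[iu iv] _].
have S : (\sum_k w k = (m%:R + 2) / N)%R.
  rewrite /w -mulr_suml; congr (_ / _)%R.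
  rewrite (eq_bigr (fun k : 'I_m => 1 + (k == u)%:R + (k == v)%:R)%R); last first.
    move=> k _; have [->|ku] := eqVneq k u; first by rewrite (negbTE uv) /=; ring.
    by case: eqP => _ /=; ring.
  by rewrite !big_split/= sumr_const card_ord !sum_delta; ring.
have := S; rewrite (bigD1 i)//= {1}/w (negbTE iu) (negbTE iv) /=.
have -> : N = (m%:R + 1)%R by rewrite /N -natr1.
move=> /(canRL (addKr _)) ->; field.
by rewrite natr1 pnatr_eq0.
Qed.

Let GP k : nnmeas (G k).
Proof.
have mg : measurable_fun setT
    (fun p : m.-tuple mR * mR => (p.1, p.2 + h k p.1)%R : m.-tuple mR * mR).
  apply: measurable_fun_pair; first exact: measurable_fst.
  apply: measurable_funD; first exact: measurable_snd.
  exact: (measurableT_comp (mh k) measurable_fst).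
exact: (nnmeas_comp (nnmeas_hat k (FP k)) mg).
Qed.

Let PP k : nnmeas (P k).
Proof. exact: (nnmeas_int lambda (nnmeas_hat k (FP k))). Qed.

Let TP k : nnmeas (T k).
Proof.
rewrite /T; case: (k == u); last exact: (nnmeas_int lambda (GP k)).
exact: (nnmeas_int lambda (nnmeas_poweR (2 / 3) (nnmeasM (GP u) (GP v)))).
Qed.

(** Translation invariance in t removes the height of the projection. *)
Let TE k : k != u -> T k = P k.
Proof.
move=> ku; apply/funext => x; rewrite /T (negbTE ku).
exact: (integral_translate (h k x)
  (nnmeas_comp (nnmeas_hat k (FP k)) (measurable_pair1 x))).
Qed.

(** Hoelder in the variable t. The pair has the weight 2/N for each function,
    that is 3/N for the power 2/3 of their product. *)
Let prod_le x :
  \int[lambda]_t (\prod_k G k (x, t) `^ w k) <= \prod_(k | k != v) T k x `^ w' k.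
Proof.
pose H k t := if k == u then (G u (x, t) * G v (x, t)) `^ (2 / 3) else G k (x, t).
have HP k : nnmeas (H k).
  rewrite /H; case: (k == u); last exact: (nnmeas_comp (GP k) (measurable_pair1 x)).
  exact: (nnmeas_comp (nnmeas_poweR (2 / 3) (nnmeasM (GP u) (GP v)))
    (measurable_pair1 x)).
rewrite (eq_integral (fun t => \prod_(k | k != v) H k t `^ w' k)); last first.
  move=> t _; rewrite (bigD1 u)//= (bigD1 v)/= 1?eq_sym// muleA.
  rewrite [in RHS](bigD1 u)//= {1}/H /w' /w !eqxx (eq_sym v) (negbTE uv) /=.
  congr (_ * _).
    rewrite -poweRrM (_ : (2 / 3 * (3 / N) = 2 / N)%R); last first.
      by field; rewrite gt_eqF.
    by rewrite poweRM ?(GP _).2.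
  rewrite (eq_bigl (fun k => (k != v) && (k != u))); last by move=> k; rewrite andbC.
  by apply: eq_bigr => k /andP[/negbTE kv /negbTE ku]; rewrite /H ku kv.
by apply: hoelder_poweR => // k; [exact: (HP k).1|exact: (HP k).2].
Qed.

(** For frozen other coordinates, the functions of the pair are functions of
    (x_v, t) and (x_u, t): the Heisenberg case. *)
Let pair_bound x :
  coord_int u (coord_int v (T u)) x <= A * (Q u x * Q v x) `^ (2 / 3).
Proof.
pose Phi (p : mR * mR) := F u (hat u (set_coord x v p.1) p.2).
pose Psi (p : mR * mR) := F v (hat v (set_coord x u p.1) p.2).
have mset i : measurable_fun setT
    (fun p : mR * mR => (set_coord x i p.1, p.2) : m.-tuple mR * mR).
  apply: measurable_fun_pair; last exact: measurable_snd.
  exact: (measurableT_comp (measurable_set_coordr i x) measurable_fst).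
have Phi_P : nnmeas Phi.
  exact: (nnmeas_comp (nnmeas_hat u (FP u)) (mset v)).
have Psi_P : nnmeas Psi.
  exact: (nnmeas_comp (nnmeas_hat v (FP v)) (mset u)).
have QuE : Q u x = \int[lambda \x lambda]_p Phi p by rewrite (tonelli Phi_P) /Q eqxx.
have QvE : Q v x = \int[lambda \x lambda]_p Psi p.
  by rewrite (tonelli Psi_P) /Q eq_sym (negbTE uv) eqxx.
rewrite QuE QvE; apply: le_trans (heisenberg_bound c0 Phi_P Psi_P).
apply: eq_lee.
apply: eq_integral => a _; apply: eq_integral => b _; rewrite /T eqxx.
apply: eq_integral => t _; rewrite /G /Phi /Psi /= hu hv.
rewrite !tnth_set_coord eqxx (negbTE uv) eqxx.
by rewrite [hat v _ _]hat_set_coord (set_coordC _ _ _ uv) hat_set_coord.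
Qed.

Let QP k : nnmeas (Q k).
Proof. by rewrite /Q; do 2?case: ifP => _; do ?apply: nnmeas_coord_int. Qed.

Let indepP k : indep k (P k).
Proof. by move=> x a; apply: eq_integral => s _; rewrite hat_set_coord. Qed.

Let indepQ k : indep k (Q k).
Proof.
rewrite /Q; have [->|ku] := eqVneq k u.
  by apply: (@indep_coords_int _ _ _ _ [:: v]) => //; rewrite inE.
have [->|kv] := eqVneq k v.
  by apply: (@indep_coords_int _ _ _ _ [:: u]) => //; rewrite inE eq_sym.
by apply: (@indep_coords_int _ _ _ _ [:: u; v]) => //; rewrite !inE negb_or ku.
Qed.

Let A0 : 0 <= A.
Proof. by rewrite mule_ge0 ?radonN_ge0// lee_fin powR_ge0. Qed.

Let block_bound x :
  coord_int u (coord_int v (fun x => \int[lambda]_t (\prod_k G k (x, t) `^ w k))) x <=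
  A `^ (3 / N) * \prod_k Q k x `^ w k.
Proof.
have GwP : nnmeas (fun x => \int[lambda]_t (\prod_k G k (x, t) `^ w k)).
  apply: (nnmeas_int lambda (f := fun p => \prod_k G k p `^ w k)).
  by apply: nnmeas_prod => k; exact: nnmeas_poweR.
apply: (@le_trans _ _
    (coord_int u (coord_int v (fun x => \prod_(k | k != v) T k x `^ w' k)) x)).
  by apply: (@le_coords_int _ _ [:: u; v]) => y; [exact: GwP.2|exact: prod_le].
apply: (@le_trans _ _
    (coord_int u (fun x => \prod_(k | k != v) coord_int v (T k) x `^ w' k) x)).
  apply: (@le_coords_int _ _ [:: u]) => y; last exact: coord_int_hoelder.
  apply: integral_ge0 => a _; apply: prode_ge0 => k _; exact: poweR_ge0.
apply: le_trans (@coord_int_hoelder _ m u (fun k => k != v)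
  (fun k => coord_int v (T k)) w' x
  (fun k => nnmeas_coord_int v (TP k)) w'_ge0 sum_w') _.
rewrite (bigD1 u)//= [in leRHS](bigD1 u)//= [in leRHS](bigD1 v)/= 1?eq_sym// !muleA.
have -> : \prod_(k | (k != v) && (k != u)) coord_int u (coord_int v (T k)) x `^ w' k =
    \prod_(k | (k != u) && (k != v)) Q k x `^ w k.
  rewrite (eq_bigl (fun k => (k != u) && (k != v))); last by move=> k; rewrite andbC.
  apply: eq_bigr => k /andP[ku kv]; rewrite (TE ku) /Q /w /w'.
  by rewrite (negbTE ku) (negbTE kv).
apply: lee_wpmul2r; first by apply: prode_ge0 => k _; exact: poweR_ge0.
rewrite /w' /w !eqxx orbT /=.
have N30 : (0 <= 3 / N)%R by rewrite divr_ge0 ?(ltW N0).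
apply: le_trans (ge0_le_poweR N30 _ (pair_bound x)) _.
  by apply: integral_ge0 => a _; apply: integral_ge0 => b _; exact: (TP u).2.
rewrite poweRM ?poweR_ge0// -muleA; apply: lee_wpmul2l; first exact: poweR_ge0.
rewrite -poweRrM (_ : (2 / 3 * (3 / N) = 2 / N)%R); last by field; rewrite gt_eqF.
by rewrite poweRM ?(QP _).2.
Qed.

Let mem_rest i : (i \in rest) = (i != u) && (i != v).
Proof. by rewrite mem_filter mem_enum andbT. Qed.

Let coords_int_restQ k x :
  coords_int [seq i <- rest | i != k] (Q k) x = \int[borel_lebesgue m]_y F k y.
Proof.
have urest : uniq rest by rewrite filter_uniq// enum_uniq.
have U (s : seq 'I_m) : uniq s ->
    (forall i, (i \in s) = (i != k)) ->
    coords_int s (P k) x = \int[borel_lebesgue m]_y F k y.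
  move=> us sE; rewrite -(coords_int_hat k x (FP k)); apply: (congr1 (fun f => f x)).
  apply: (coords_int_perm (PP k)); apply: uniq_perm => //;
    first by rewrite filter_uniq// enum_uniq.
  by move=> i; rewrite sE mem_filter mem_enum andbT.
rewrite /Q; have [ku|ku] := eqVneq k u.
  rewrite -[coord_int v (P u)]/(coords_int [:: v] (P u)) -ku -coords_int_cat; apply: U.
    rewrite cat_uniq filter_uniq//= orbF andbT mem_filter mem_rest eqxx.
    by rewrite /= !andbF.
  move=> i; rewrite mem_cat mem_filter mem_rest inE ku.
  by have [->|iv] := eqVneq i v; rewrite ?andbF ?orbF ?andbT ?andbb// eq_sym.
have [kv|kv] := eqVneq k v.
  rewrite -[coord_int u (P v)]/(coords_int [:: u] (P v)) -kv -coords_int_cat; apply: U.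
    rewrite cat_uniq filter_uniq//= orbF andbT mem_filter mem_rest eqxx.
    by rewrite /= !andbF.
  move=> i; rewrite mem_cat mem_filter mem_rest inE kv.
  by have [->|iu] := eqVneq i u; rewrite ?andbF ?orbF ?andbT ?andbb.
rewrite -[coord_int u _]/(coords_int [:: u; v] (P k)) -coords_int_cat; apply: U.
  rewrite cat_uniq filter_uniq//= !mem_filter !eqxx /= !andbF /= inE.
  by rewrite uv.
move=> i; rewrite mem_cat mem_filter mem_rest !inE.
have [->|iu] := eqVneq i u; first by rewrite eq_sym ku andbF.
have [->|iv] := eqVneq i v; first by rewrite eq_sym kv andbF.
by rewrite /= orbF andbT.
Qed.

(** The variables t, u and v are integrated first ([block_bound]); what remains,
    over the other coordinates, is a Loomis-Whitney inequality for the functions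
    Q k. Its constant is 1, so that the only loss is the Heisenberg constant
    A. *)
Lemma one_pair_bound :
  \int[borel_lebesgue m]_x \int[lambda]_t
     (\prod_k F k (hat k x (t + h k x)%R) `^ w k) <=
  A `^ (3 / N) * \prod_k (\int[borel_lebesgue m]_y F k y) `^ w k.
Proof.
pose L x := \int[lambda]_t (\prod_k G k (x, t) `^ w k).
have LP : nnmeas L.
  apply: (nnmeas_int lambda (f := fun p => \prod_k G k p `^ w k)).
  by apply: nnmeas_prod => k; exact: nnmeas_poweR.
have urest : uniq rest by rewrite filter_uniq// enum_uniq.
pose x0 : m.-tuple mR := [tuple 0%R | i < m].
rewrite -[leLHS]/(\int[borel_lebesgue m]_x L x) -(coords_int_enum x0 LP).
rewrite (coords_int_perm (s2 := rest ++ [:: u; v]) LP); last first.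
  apply: uniq_perm; rewrite ?enum_uniq//.
    by rewrite cat_uniq urest /= !mem_rest !eqxx /= !andbF inE uv.
  move=> i; rewrite mem_cat mem_rest mem_enum !inE.
  by case: (i == u); case: (i == v).
have AN0 : 0 <= A `^ (3 / N) by exact: poweR_ge0.
have PQP : nnmeas (fun x => \prod_k Q k x `^ w k).
  by apply: nnmeas_prod => k; exact: nnmeas_poweR.
rewrite coords_int_cat.
apply: (@le_trans _ _
    (coords_int rest (fun x => A `^ (3 / N) * \prod_k Q k x `^ w k) x0)).
  apply: le_coords_int => y; last exact: block_bound.
  exact: (nnmeas_coords_int [:: u; v] LP).2.
have -> : coords_int rest (fun x => A `^ (3 / N) * \prod_k Q k x `^ w k) x0 =
    A `^ (3 / N) * coords_int rest (fun x => \prod_k Q k x `^ w k) x0.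
  elim: (rest) x0 => //= i s IHs x.
  rewrite /coord_int; under eq_integral do rewrite IHs.
  apply: nnmeas_integralZl => //.
  exact: (nnmeas_comp (nnmeas_coords_int s PQP) (measurable_set_coordr i x)).
apply: lee_wpmul2l => //.
apply: le_trans (coords_int_finner urest QP indepQ w_ge0 sum_w x0) _.
apply: eq_lee; apply: eq_bigr => k _.
by rewrite coords_int_restQ.
Qed.

End pair.
End one_pair.

(** * A single Carnot group *)

Section carnot_bound.
Context {R : realType}.
Local Notation mR := (measurableTypeR R).
Local Notation lambda := (@lebesgue_measure R).
Local Notation radonN := (radon_norm (3 / 2 : R) 3).

Variables (d n : nat) (alpha : n.-tuple R).
Hypothesis n0 : (0 < n)%N.
Hypothesis alpha0 : forall i, (0 < tnth alpha i)%R.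

Let m := (d + 2 * n)%N.
Let N : R := m.+1%:R.

(** The projections of the group are shears in t followed by the deletion of a
    coordinate. *)
Definition height (k : 'I_m) (x : m.-tuple mR) : R := proj_height d alpha k x 0.

Lemma projE (k : 'I_m) (p : m.-tuple mR * mR) :
  Defs.proj alpha k p = hat k p.1 (p.2 + height k p.1)%R.
Proof.
apply: val_inj => /=; rewrite /proj_seq /height /proj_height.
by case: ifP => _; [rewrite addr0|case: ifP => _; rewrite ?sub0r ?add0r].
Qed.

Lemma measurable_nth (i : nat) :
  measurable_fun setT (fun x : m.-tuple mR => nth 0%R x i : mR).
Proof.
have [im|mi] := ltnP i m.
  rewrite (_ : (fun _ => _) = fun x => tnth x (Ordinal im)); last first.
    by apply/funext => x; rewrite (tnth_nth 0%R).
  exact: measurable_tnth.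
rewrite (_ : (fun _ => _) = cst 0%R); first exact: measurable_cst.
by apply/funext => x; rewrite nth_default// size_tuple.
Qed.

Lemma measurable_height k : measurable_fun setT (height k).
Proof.
rewrite /height /proj_height; case: (k < d)%N => /=; first exact: measurable_cst.
case: (odd (k - d)) => /=; [apply: measurable_funB|apply: measurable_funD];
  do ?[exact: measurable_cst | apply: measurable_funM | exact: measurable_nth].
Qed.

Lemma measurable_proj k :
  measurable_fun setT (Defs.proj alpha k : m.-tuple mR * mR -> m.-tuple mR).
Proof.
have mg : measurable_fun setT
    (fun p : m.-tuple mR * mR => (p.1, p.2 + height k p.1)%R : m.-tuple mR * mR).
  apply: measurable_fun_pair; first exact: measurable_fst.
  apply: measurable_funD; first exact: measurable_snd.
  exact: (measurableT_comp (measurable_height k) measurable_fst).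
rewrite (_ : Defs.proj alpha k = fun p => hat k p.1 (p.2 + height k p.1)%R).
  exact: (measurableT_comp (measurable_hat k) mg).
by apply/funext => p; exact: projE.
Qed.

Let u_subproof (i : 'I_n) :
  (d + 2 * i < m)%N. Proof. by have := ltn_ord i; rewrite /m; lia. Qed.
Let v_subproof (i : 'I_n) :
  ((d + 2 * i).+1 < m)%N. Proof. by have := ltn_ord i; rewrite /m; lia. Qed.
Let u (i : 'I_n) : 'I_m := Ordinal (u_subproof i).
Let v (i : 'I_n) : 'I_m := Ordinal (v_subproof i).

Let half_u (i : nat) : ((d + 2 * i - d)./2 = i)%N /\ (((d + 2 * i).+1 - d)./2 = i)%N.
Proof. by split; lia. Qed.

Let height_u i x : height (u i) x = (tnth alpha i / 2 * tnth x (u i) * tnth x (v i))%R.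
Proof.
rewrite /height /proj_height /= ltnNge leq_addr /=.
rewrite (half_u i).1 (_ : odd (d + 2 * i - d) = false); last by rewrite addKn oddM.
by rewrite add0r !(tnth_nth 0%R).
Qed.

Let height_v i x :
  height (v i) x = (- (tnth alpha i / 2 * tnth x (u i) * tnth x (v i)))%R.
Proof.
rewrite /height /proj_height /= ltnNge (leq_trans (leq_addr (2 * i) d)) //=.
rewrite (half_u i).2 (_ : odd ((d + 2 * i).+1 - d) = true); last first.
  by rewrite subSn ?leq_addr// addKn /= oddM.
by rewrite sub0r !(tnth_nth 0%R).
Qed.

Let w (i : 'I_n) (k : 'I_m) : R := ((if (k == u i) || (k == v i) then 2 else 1) / N)%R.

Definition carnot_weight (k : 'I_m) : R :=
  (if (k < d)%N then N^-1 else n.+1%:R / (n%:R * N))%R.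

Let N0 : (0 < N)%R. Proof. by rewrite ltr0n. Qed.
Let nr0 : (0 < n%:R :> R)%R. Proof. by rewrite ltr0n. Qed.

Lemma carnot_weight_ge0 k : (0 <= carnot_weight k)%R.
Proof.
rewrite /carnot_weight; case: ifP => _; first by rewrite invr_ge0 ltW.
by rewrite divr_ge0// mulr_ge0// ltW.
Qed.

Let w_ge0 i k : (0 <= w i k)%R.
Proof. by rewrite /w divr_ge0 ?(ltW N0)//; case: ifP. Qed.

(** A coordinate of index at least d belongs to exactly one of the n pairs, the
    others to none. *)
Let weight_mean k : (\sum_i w i k / n%:R = carnot_weight k)%R.
Proof.
rewrite -mulr_suml /w -mulr_suml /carnot_weight.
case: ltnP => kd.
  rewrite (eq_bigr (fun=> 1%R)); last first.
    move=> i _; rewrite -!(inj_eq val_inj) /=.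
    by rewrite !ltn_eqF//; lia.
  by rewrite sumr_const card_ord; field; rewrite gt_eqF//= gt_eqF.
have jn : ((k - d)./2 < n)%N by have := ltn_ord k; rewrite /m; lia.
pose j := Ordinal jn.
rewrite (eq_bigr (fun i : 'I_n => 1 + (i == j)%:R)%R); last first.
  move=> i _; rewrite -!(inj_eq val_inj) /=.
  have -> : ((k : nat) == (d + 2 * i)%N) || ((k : nat) == (d + 2 * i).+1) =
     (nat_of_ord i == (k - d)./2)%N.
    by apply/orP/eqP => [[/eqP|/eqP]|]; lia.
  by case: eqP => _ /=; ring.
rewrite big_split/= sumr_const card_ord (bigD1 j)//= eqxx big1 ?addr0; last first.
  by move=> i /negbTE ->.
by rewrite -[n.+1%:R]natr1 /=; field; rewrite gt_eqF//= gt_eqF.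
Qed.

(** The product of the powers F_k ^ (carnot_weight k) is the geometric mean,
    over the pairs i, of the products with the weights w i; Hoelder with n equal
    weights reduces to [one_pair_bound]. *)
Lemma carnot_bound (F : 'I_m -> m.-tuple mR -> \bar R) :
  (forall k, nnmeas (F k)) ->
  \int[@carnot_lebesgue R m]_p (\prod_k F k (Defs.proj alpha k p) `^ carnot_weight k) <=
  radonN `^ (3 / N) * ((\prod_i tnth alpha i) `^ (- (n%:R * N)^-1))%:E *
  \prod_k (\int[borel_lebesgue m]_y F k y) `^ carnot_weight k.
Proof.
move=> FP.
pose E i (p : m.-tuple mR * mR) := \prod_k F k (Defs.proj alpha k p) `^ w i k.
have FpP k : nnmeas (fun p : m.-tuple mR * mR => F k (Defs.proj alpha k p)).
  exact: (nnmeas_comp (FP k) (measurable_proj k)).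
have EP i : nnmeas (E i) by apply: nnmeas_prod => k; exact: nnmeas_poweR.
have I0 k : 0 <= \int[borel_lebesgue m]_y F k y.
  by apply: integral_ge0 => y _; exact: (FP k).2.
have pE p : \prod_k F k (Defs.proj alpha k p) `^ carnot_weight k =
    \prod_i E i p `^ n%:R^-1.
  have -> : \prod_i E i p `^ n%:R^-1 =
      \prod_i \prod_k (F k (Defs.proj alpha k p) `^ w i k) `^ n%:R^-1.
    by apply: eq_bigr => i _; apply: poweR_prod => k; exact: poweR_ge0.
  rewrite exchange_big/=; apply: eq_bigr => k _; rewrite -weight_mean.
  rewrite -poweR_sum; last by move=> i; apply: divr_ge0; [exact: w_ge0|exact: ltW].
  by apply: eq_bigr => i _; rewrite poweRrM.
under eq_integral do rewrite pE.
apply: le_trans (hoelder_poweR (@carnot_lebesgue R m)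
  (fun i => (EP i).1) (fun i => (EP i).2) _ _) _.
- by move=> i; rewrite invr_ge0 ltW.
- by rewrite sumr_const card_ord -[LHS]mulr_natr mulVf// gt_eqF.
pose A i := ((tnth alpha i) `^ (- 3^-1))%:E * radonN.
have A0 i : 0 <= A i by rewrite mule_ge0 ?radonN_ge0// lee_fin powR_ge0.
have Ebound i : \int[@carnot_lebesgue R m]_p E i p <=
    A i `^ (3 / N) * \prod_k (\int[borel_lebesgue m]_y F k y) `^ w i k.
  have uv : u i != v i by rewrite -(inj_eq val_inj) /= ltn_eqF.
  have a20 : (0 < tnth alpha i / 2)%R by rewrite divr_gt0.
  have := one_pair_bound measurable_height uv a20 (height_u i) (height_v i) FP.
  rewrite [(2 * _)%R]mulrC divfK//; apply: le_trans.
  rewrite -[leLHS]/(\int[borel_lebesgue m \x lambda]_p E i p).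
  rewrite (fubini_tonelli1 _ (EP i).1 (EP i).2).
  apply: eq_lee; apply: eq_integral => x _.
  by apply: eq_integral => t _; apply: eq_bigr => k _; rewrite projE.
apply: (@le_trans _ _ (\prod_i (A i `^ (3 / N) *
    \prod_k (\int[borel_lebesgue m]_y F k y) `^ w i k) `^ n%:R^-1)).
  apply: ge0_le_prod => i; first exact: poweR_ge0.
  apply: ge0_le_poweR => //.
  by apply: integral_ge0 => p _; exact: (EP i).2.
apply: eq_lee.
rewrite (eq_bigr (fun i => (A i `^ (3 / N)) `^ n%:R^-1 *
    (\prod_k (\int[borel_lebesgue m]_y F k y) `^ w i k) `^ n%:R^-1)); last first.
  move=> i _; rewrite poweRM ?poweR_ge0//.
  by apply: prode_ge0 => k _; exact: poweR_ge0.
rewrite big_split/=; congr (_ * _).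
  transitivity (\prod_i ((tnth alpha i `^ (- (n%:R * N)^-1))%:E *
      radonN `^ (3 / N / n%:R))).
    apply: eq_bigr => i _; rewrite -poweRrM poweRM ?radonN_ge0 ?lee_fin ?powR_ge0//.
    congr (_ * _); rewrite poweR_EFin -powRrM; congr ((_ `^ _)%:E)%R.
    by field; rewrite gt_eqF//= gt_eqF.
  rewrite big_split/= muleC; congr (_ * _).
    rewrite poweR_sum; last by move=> i; rewrite !divr_ge0// ltW.
    by rewrite sumr_const card_ord -[X in _ `^ X]mulr_natr divfK// gt_eqF.
  by rewrite -poweR_EFin -prodEFin poweR_prod// => i; rewrite lee_fin ltW.
rewrite (eq_bigr (fun i => \prod_k (\int[borel_lebesgue m]_y F k y) `^ (w i k / n%:R))).
  rewrite exchange_big/=; apply: eq_bigr => k _; rewrite -weight_mean poweR_sum//.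
  by move=> i; apply: divr_ge0; [exact: w_ge0|exact: ltW].
move=> i _; rewrite poweR_prod; last by move=> k; exact: poweR_ge0.
by apply: eq_bigr => k _; rewrite poweRrM.
Qed.

End carnot_bound.

(** * Borel majorants of Lebesgue measurable functions *)

Section completion.
Context d (T : measurableType d) {R : realType}
  (mu : {measure set T -> \bar R}).
Local Notation cT := (caratheodory_type (mu^*)%mu).
Local Notation nu := (@completed_measure_extension _ _ _ mu).

Lemma measurable_cara (A : set T) : measurable A -> measurable (A : set cT).
Proof. exact: caratheodory_measurable_mu_ext. Qed.

Lemma completedE (A : set T) : measurable A -> nu A = mu A.
Proof. exact: measurable_mu_extE. Qed.

Lemma measurable_completed_id : measurable_fun [set: cT] (id : cT -> T).
Proof. by move=> _ A mA; rewrite setTI; exact: measurable_cara. Qed.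

Lemma integral_completed (g : T -> \bar R) : nnmeas g ->
  \int[nu]_x g x = \int[mu]_x g x.
Proof.
move=> gP; rewrite -(integral_push nu measurable_completed_id gP).
by apply: eq_measure_integral => A mA _; exact: completedE.
Qed.

(** The intersection of countable covers of A by measurable sets whose measures
    tend to the outer measure of A; finiteness is used to subtract. *)
Lemma outer_hull_fin (A : set cT) : measurable A -> nu A < +oo ->
  exists B : set T, [/\ measurable B, A `<=` B & nu (B `\` A) = 0].
Proof.
move=> mA Aoo; have A0 : 0 <= nu A by exact: measure_ge0.
have Afin : nu A \is a fin_num by rewrite ge0_fin_numE.
(* Covers exceeding the outer measure by at most 1/(k+1). *)
have cover k : exists B : set T,
    [/\ measurable B, A `<=` B & mu B <= nu A + k.+1%:R^-1%:E].
  have k0 : (0 < k.+1%:R^-1 :> R)%R by rewrite invr_gt0.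
  have [_ [F [mF AF] <-] FA] := lb_ereal_inf_adherent k0 Afin.
  exists (\bigcup_i F i); split => //; first exact: bigcupT_measurable.
  apply: le_trans (ltW FA); apply: measure_sigma_subadditive => //.
  exact: bigcupT_measurable.
have /choice[B BP] := cover.
exists (\bigcap_k B k).
have mB : measurable (\bigcap_k B k).
  by apply: bigcapT_measurable => k; have [] := BP k.
have AB : A `<=` \bigcap_k B k by apply: sub_bigcap => k _; have [] := BP k.
split => //; have BA : nu (\bigcap_k B k) <= nu A.
  apply/lee_addgt0Pr => e e0.
  have [k /ltW ke] := ltr_add_invr e0; rewrite add0r in ke.
  apply: (@le_trans _ _ (nu A + k.+1%:R^-1%:E)); last by rewrite leeD2l// lee_fin.
  have [mBk _] := BP k; apply: le_trans; rewrite completedE// le_measure ?inE//.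
  exact: bigcap_inf.
have mDA : measurable ((\bigcap_k B k : set cT) `\` A).
  by apply: measurableD => //; exact: measurable_cara.
move: BA; rewrite (measureDI nu (measurable_cara mB) mA) (setIidr AB).
rewrite -[leRHS]add0e leeD2rE// => D0.
by apply/eqP; rewrite -measure_le0.
Qed.

Lemma null_bigcup (D : nat -> set cT) : (forall n, measurable (D n)) ->
  (forall n, nu (D n) = 0) -> nu (\bigcup_n D n) = 0.
Proof.
move=> mD D0; apply/eqP; rewrite -measure_le0.
apply: (@le_trans _ _ (\sum_(n <oo) nu (D n))); last by rewrite eseries0.
by apply: measure_sigma_subadditive => //; exact: bigcupT_measurable.
Qed.

End completion.

Section borel_hull.
Context d (T : measurableType d) {R : realType}
  (mu : {sigma_finite_measure set T -> \bar R}).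
Local Notation cT := (caratheodory_type (mu^*)%mu).
Local Notation nu := (@completed_measure_extension _ _ _ mu).

Lemma outer_hull (A : set cT) : measurable A ->
  exists B : set T, [/\ measurable B, A `<=` B & nu (B `\` A) = 0].
Proof.
move=> mA; have [F FT FP] := sigma_finiteT mu.
have hull n : exists B : set T,
    [/\ measurable B, A `&` F n `<=` B & nu (B `\` (A `&` F n)) = 0].
  have mFn := measurable_cara mu (FP n).1.
  apply: outer_hull_fin; first exact: measurableI.
  apply: (@le_lt_trans _ _ (nu (F n))).
    by apply: le_measure; rewrite ?inE//; exact: measurableI.
  by rewrite (completedE mu (FP n).1); exact: (FP n).2.
have /choice[B BP] := hull; exists (\bigcup_n B n).
have mB : measurable (\bigcup_n B n).
  by apply: bigcupT_measurable => n; have [] := BP n.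
split => //.
  move=> x Ax; have [n _ Fnx] : (\bigcup_n F n) x by rewrite -FT.
  by exists n => //; have [_ + _] := BP n; apply.
have mD n : measurable ((B n : set cT) `\` (A `&` F n)).
  apply: measurableD; first by apply: (measurable_cara mu); have [] := BP n.
  by apply: measurableI => //; exact: (measurable_cara mu (FP n).1).
have D0 n : nu (B n `\` (A `&` F n)) = 0 by have [] := BP n.
apply/eqP; rewrite -measure_le0 -[leRHS](null_bigcup mD D0).
apply: le_measure; rewrite ?inE//.
- by apply: measurableD => //; exact: (measurable_cara mu).
- exact: bigcupT_measurable.
- by move=> x [[n _ Bnx] Ax]; exists n => //; split => // -[].
Qed.

(** The sets {r < f}, for r rational, are enlarged by null sets to sets B_r that
    are measurable before completion, and the majorant is the supremum of the
    functions r 1_(B_r). *)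
Lemma borel_majorant (f : cT -> \bar R) : nnmeas f ->
  exists g : T -> \bar R, [/\ nnmeas g, forall x, f x <= g x &
    {ae nu, forall x, g x = f x}].
Proof.
move=> [mf f0].
pose r (n : nat) : R := if unpickle n is Some q then ratr `|q : rat| else 0%R.
have r0 n : (0 <= r n)%R.
  by rewrite /r; case: unpickle => // q; rewrite ler0q.
have mA n : measurable [set x : cT | (r n)%:E < f x].
  rewrite -[X in measurable X]setTI.
  exact: emeasurable_fun_o_infty.
have /choice[B BP] := fun n => outer_hull (mA n).
pose s n x := (r n * \1_(B n) x)%:E : \bar R.
have mB n : measurable (B n) by have [] := BP n.
have ms n : measurable_fun setT (s n).
  by apply/measurable_EFinP; apply: measurable_funM => //; exact: measurable_indic.
have s0 n x : 0 <= s n x by rewrite lee_fin mulr_ge0.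
pose g x := esups (s ^~ x) 0%N.
have s_g n x : s n x <= g x by apply: ereal_sup_ubound; exists n.
have g0 x : 0 <= g x by exact: le_trans (s_g 0%N x).
have gP : nnmeas g by split => //; exact: measurable_fun_esups.
have fg x : f x <= g x.
  rewrite leNgt; apply/negP => gf.
  have gfin : g x \is a fin_num by rewrite ge0_fin_numE// (lt_le_trans gf)// leey.
  (* A rational between g x and f x contradicts g x < f x; b replaces f x when
     f x is infinite. *)
  pose b := if f x is b'%:E then b' else (fine (g x) + 1)%R.
  have bf : b%:E <= f x.
    rewrite /b; have := f0 x; case: (f x) => [//|_|//]; exact: leey.
  have gb : (fine (g x) < b)%R.
    rewrite /b; case: (f x) gf => [b'|_|].
    - by rewrite -lte_fin fineK.
    - by rewrite ltrDl.
    - by rewrite ltNge leNye.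
  have [q] := rat_in_itvoo gb; rewrite in_itv/= => /andP[gq qb].
  have q0 : (0 < q)%R.
    by rewrite -(ltr0q R); apply: le_lt_trans gq; rewrite fine_ge0.
  have rE : r (pickle q) = ratr q by rewrite /r pickleK gtr0_norm.
  have Bx : B (pickle q) x.
    have [_ + _] := BP (pickle q); apply => /=.
    by rewrite rE (lt_le_trans _ bf)// lte_fin.
  have := s_g (pickle q) x.
  by rewrite /s indicE mem_set// mulr1 rE -[g x]fineK// lee_fin leNgt gq.
exists g; split => //.
exists (\bigcup_n (B n `\` [set x : cT | (r n)%:E < f x])).
split.
- apply: bigcupT_measurable => n; apply: measurableD => //.
  exact: (measurable_cara mu).
- apply: null_bigcup => n; last by have [] := BP n.
  by apply: measurableD => //; exact: (measurable_cara mu).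
- move=> x /= gfx; have {}gfx : f x < g x.
    by rewrite lt_neqAle fg andbT eq_sym; apply/eqP.
  have [_ [n _ <-] fs] := ereal_sup_gt gfx.
  exists n => //; split.
    apply: contrapT => nB; move: fs; rewrite /s indicE memNset// mulr0.
    by rewrite ltNge f0.
  move=> /= rf; move: fs; rewrite ltNge; move/negP; apply.
  apply: le_trans (ltW rf); rewrite lee_fin /s indicE; case: (_ \in _) => /=.
    by rewrite mulr1.
  by rewrite mulr0.
Qed.

End borel_hull.

(** * The product of two Carnot groups *)

Section product_bound.
Context {R : realType}.
Local Notation mR := (measurableTypeR R).
Local Notation lambda := (@lebesgue_measure R).
Local Notation radonN := (radon_norm (3 / 2 : R) 3).

(** The point (x, t) of the group as a point of R^(m+1). *)
Definition flat m (p : m.-tuple mR * mR) : m.+1.-tuple mR :=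
  insert_coord ord_max p.2 p.1.

Lemma val_flat m (p : m.-tuple mR * mR) : flat p = rcons p.1 p.2 :> seq R.
Proof. exact: insert_coord_max_rcons. Qed.

Lemma measurable_flat m : measurable_fun setT (@flat m).
Proof.
have ms : measurable_fun setT
    (fun p : m.-tuple mR * mR => (p.2, p.1) : mR * m.-tuple mR).
  by apply: measurable_fun_pair; [exact: measurable_snd|exact: measurable_fst].
exact: (measurableT_comp (measurable_insert_coord ord_max) ms).
Qed.

Lemma integral_flat m (G : m.+1.-tuple mR -> \bar R) : nnmeas G ->
  \int[@carnot_lebesgue R m]_p G (flat p) = \int[borel_lebesgue m.+1]_x G x.
Proof.
move=> GP; have GfP := nnmeas_comp GP (@measurable_flat m).
rewrite -[LHS]/(\int[borel_lebesgue m \x lambda]_p (G \o @flat m) p).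
rewrite (fubini_tonelli1 _ GfP.1 GfP.2).
exact/esym/(integral_rcons (c := fun y s => flat (y, s))
  (fun y s => val_flat (y, s)) GP).
Qed.

Lemma measurable_tcast a b (e : a = b) :
  measurable_fun setT (fun x : a.-tuple mR => tcast e x).
Proof. by case: _ / e; exact: measurable_id. Qed.

(** The sum is e/M + 2k(k+1)/(kM), where M = e + 2k + 1. *)
Lemma sum_carnot_weight (e k : nat) : (0 < k)%N ->
  (\sum_(i < e + 2 * k) @carnot_weight R e k i =
   ((e + 2 * k).+1%:R + 1) / (e + 2 * k).+1%:R)%R.
Proof.
move=> k0; have kr : (k%:R != 0 :> R)%R by rewrite pnatr_eq0 -lt0n.
have Nr : ((e + 2 * k).+1%:R != 0 :> R)%R by rewrite pnatr_eq0.
rewrite big_split_ord/= (eq_bigr (fun=> (e + 2 * k).+1%:R^-1)%R); last first.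
  by move=> i _; rewrite /carnot_weight /= ltn_ord.
rewrite [X in (_ + X)%R](eq_bigr (fun=> k.+1%:R / (k%:R * (e + 2 * k).+1%:R))%R);
  last first.
  by move=> i _; rewrite /carnot_weight /= ltnNge leq_addr.
rewrite !sumr_const !card_ord -[(_ *+ e)%R]mulr_natr -[(_ *+ (2 * k))%R]mulr_natr natrM.
have -> : ((e + 2 * k).+1%:R + 1 = e%:R + 2 * k%:R + 2 :> R)%R.
  by rewrite -natr1 natrD natrM; ring.
rewrite -[k.+1%:R]natr1; move: Nr; set M := (e + 2 * k).+1%:R; clearbody M => Nr.
by field; rewrite kr Nr.
Qed.

Variables (d n : nat) (alpha : n.-tuple R) (d' n' : nat) (alpha' : n'.-tuple R).
Hypothesis n0 : (0 < n)%N.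
Hypothesis n'0 : (0 < n')%N.
Hypothesis alpha0 : forall i, (0 < tnth alpha i)%R.
Hypothesis alpha'0 : forall i, (0 < tnth alpha' i)%R.

Let m := (d + 2 * n)%N.
Let m' := (d' + 2 * n')%N.
Let N1 : R := m.+1%:R.
Let N2 : R := m'.+1%:R.
Let N : R := (m + m' + 3)%:R.
Local Notation X := (m.-tuple mR * mR)%type.
Local Notation Y := (m'.-tuple mR * mR)%type.

Let catl (z : m.-tuple mR) (y : Y) : (m + m').+1.-tuple mR :=
  tcast (addnS m m') [tuple of z ++ flat y].

Let catr (x : X) (z : m'.-tuple mR) : (m + m').+1.-tuple mR :=
  [tuple of flat x ++ z].

Let val_catl z y : catl z y = z ++ rcons y.1 y.2 :> seq R.
Proof. by rewrite val_tcast; congr (_ ++ _); exact: val_flat. Qed.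

Let pibar_l k (p : X * Y) :
  pibar alpha alpha' (lshift m' k) p = catl (Defs.proj alpha k p.1) p.2.
Proof.
by apply: val_inj; rewrite /= /pibar_seq (unsplitK (inl k)) val_catl.
Qed.

Let pibar_r k (p : X * Y) :
  pibar alpha alpha' (rshift m k) p = catr p.1 (Defs.proj alpha' k p.2).
Proof.
apply: val_inj; rewrite /= /pibar_seq (unsplitK (inr k)).
by congr (_ ++ _); exact/esym/val_flat.
Qed.

Let measurable_catl : measurable_fun setT (fun p : m.-tuple mR * Y => catl p.1 p.2).
Proof.
have mf : measurable_fun setT (fun p : m.-tuple mR * Y =>
    (p.1, flat p.2) : m.-tuple mR * m'.+1.-tuple mR).
  apply: measurable_fun_pair; first exact: measurable_fst.
  exact: (measurableT_comp (@measurable_flat m') measurable_snd).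
apply: (measurableT_comp (measurable_tcast (addnS m m'))).
exact: (measurableT_comp (@measurable_cat_tuple R m m'.+1) mf).
Qed.

Let measurable_catr : measurable_fun setT (fun p : X * m'.-tuple mR => catr p.1 p.2).
Proof.
have mf : measurable_fun setT (fun p : X * m'.-tuple mR =>
    (flat p.1, p.2) : m.+1.-tuple mR * m'.-tuple mR).
  apply: measurable_fun_pair; last exact: measurable_snd.
  exact: (measurableT_comp (@measurable_flat m) measurable_fst).
exact: (measurableT_comp (@measurable_cat_tuple R m.+1 m') mf).
Qed.

Lemma measurable_pibar j : measurable_fun setT
  (fun p : X * Y => pibar alpha alpha' j p : (m + m').+1.-tuple mR).
Proof.
case: (split_ordP j) => k ->.
  rewrite (_ : (fun _ => _) = fun p : X * Y => catl (Defs.proj alpha k p.1) p.2).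
    have mg : measurable_fun setT
        (fun p : X * Y => (Defs.proj alpha k p.1, p.2) : m.-tuple mR * Y).
      apply: measurable_fun_pair; last exact: measurable_snd.
      exact: (measurableT_comp (measurable_proj alpha k) measurable_fst).
    exact: (measurableT_comp measurable_catl mg).
  by apply/funext => p; exact: pibar_l.
rewrite (_ : (fun _ => _) = fun p : X * Y => catr p.1 (Defs.proj alpha' k p.2)).
  have mg : measurable_fun setT
      (fun p : X * Y => (p.1, Defs.proj alpha' k p.2) : X * m'.-tuple mR).
    apply: measurable_fun_pair; first exact: measurable_fst.
    exact: (measurableT_comp (measurable_proj alpha' k) measurable_snd).
  exact: (measurableT_comp measurable_catr mg).
by apply/funext => p; exact: pibar_r.
Qed.

Let integral_catl (G : (m + m').+1.-tuple mR -> \bar R) : nnmeas G ->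
  \int[@carnot_lebesgue R m']_y \int[borel_lebesgue m]_z G (catl z y) =
  \int[borel_lebesgue (m + m').+1]_x G x.
Proof.
move=> GP; have [mG G0] := nnmeas_comp GP measurable_catl.
rewrite -(fubini_tonelli _ mG G0).
pose c (z : m.-tuple mR) (v : m'.+1.-tuple mR) : (m + m').+1.-tuple mR :=
  tcast (addnS m m') [tuple of z ++ v].
rewrite (integral_cat (c := c) _ GP); last by move=> z v; rewrite val_tcast.
apply: eq_integral => z _.
apply: (@integral_flat m' (fun v => G (c z v))).
apply: (nnmeas_comp GP); apply: (measurableT_comp (measurable_tcast (addnS m m'))).
exact: (measurableT_comp (@measurable_cat_tuple R m m'.+1) (measurable_pair1 z)).
Qed.

Let integral_catr (G : (m + m').+1.-tuple mR -> \bar R) : nnmeas G ->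
  \int[borel_lebesgue m']_z \int[@carnot_lebesgue R m]_x G (catr x z) =
  \int[borel_lebesgue (m + m').+1]_x G x.
Proof.
move=> GP; have [mG G0] := nnmeas_comp GP measurable_catr.
rewrite -(fubini_tonelli _ mG G0).
pose c (v : m.+1.-tuple mR) (z : m'.-tuple mR) : (m + m').+1.-tuple mR :=
  [tuple of v ++ z].
rewrite (integral_cat (c := c) _ GP)//.
apply: (@integral_flat m (fun v => \int[borel_lebesgue m']_z G (c v z))).
exact: (nnmeas_int (borel_lebesgue m') (nnmeas_comp GP (@measurable_cat_tuple R m.+1
  m'))).
Qed.

Let N1_gt0 : (0 < N1)%R. Proof. by rewrite ltr0n. Qed.
Let N2_gt0 : (0 < N2)%R. Proof. by rewrite ltr0n. Qed.
Let N_gt0 : (0 < N)%R. Proof. by rewrite ltr0n addn3. Qed.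
Let NE : N = (N1 + N2 + 1)%R.
Proof. by rewrite /N /N1 /N2 -!natrD natr1; congr (_%:R)%R; lia. Qed.

Definition product_weight (j : 'I_(m + m')) : R :=
  match fintype.split j with
  | inl k => (N1 / N * @carnot_weight R d n k)%R
  | inr k => (N2 / N * @carnot_weight R d' n' k)%R
  end.

Let C1 := radonN `^ (3 / N1) * ((\prod_i tnth alpha i) `^ (- (n%:R * N1)^-1))%:E.
Let C2 := radonN `^ (3 / N2) * ((\prod_i tnth alpha' i) `^ (- (n'%:R * N2)^-1))%:E.

Let C_ge0 : 0 <= C1 /\ 0 <= C2.
Proof. by split; rewrite mule_ge0 ?poweR_ge0// lee_fin powR_ge0. Qed.

(** Hoelder on the first group uses the weight s = (m+1)/N for the product of
    its own functions, to which [carnot_bound] applies, and the final weights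
    for the functions of the second group, whose arguments in the second group
    are frozen. Then the same is done on the second group. The weights sum to 1
    both times because those of a single group sum to (m+2)/(m+1) and N = (m+1)
    + (m'+1) + 1. *)
Lemma product_bound (F : 'I_(m + m') -> (m + m').+1.-tuple mR -> \bar R) :
  (forall j, nnmeas (F j)) ->
  \int[@carnot_lebesgue R m \x @carnot_lebesgue R m']_p
    (\prod_j F j (pibar alpha alpha' j p) `^ product_weight j) <=
  C1 `^ (N1 / N) * C2 `^ (N2 / N) *
  \prod_j (\int[borel_lebesgue (m + m').+1]_x F j x) `^ product_weight j.
Proof.
move=> FP.
pose s := (N1 / N)%R; pose s' := (N2 / N)%R.
pose w (k : 'I_m) : R := @carnot_weight R d n k.
pose w' (k : 'I_m') : R := @carnot_weight R d' n' k.
have s0 : (0 <= s)%R by rewrite divr_ge0 ?ltW.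
have s'0 : (0 <= s')%R by rewrite divr_ge0 ?ltW.
have w0 k : (0 <= w k)%R by exact: carnot_weight_ge0.
have w'0 k : (0 <= w' k)%R by exact: carnot_weight_ge0.
have sw0 k : (0 <= s * w k)%R by exact: mulr_ge0.
have sw'0 k : (0 <= s' * w' k)%R by exact: mulr_ge0.
have sum1 : (s + \sum_k s' * w' k = 1)%R.
  rewrite -mulr_sumr sum_carnot_weight// -/N2 /s /s' NE; field.
  by rewrite !gt_eqF// -NE.
have sum2 : (s' + \sum_k s * w k = 1)%R.
  rewrite -mulr_sumr sum_carnot_weight// -/N1 /s /s' NE; field.
  by rewrite !gt_eqF// -NE.
have [C10 C20] := C_ge0.
pose Fl k (q : m.-tuple mR * Y) := F (lshift m' k) (catl q.1 q.2).
pose Fr k (q : X * m'.-tuple mR) := F (rshift m k) (catr q.1 q.2).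
have FlP k : nnmeas (Fl k) by exact: (nnmeas_comp (FP _) measurable_catl).
have FrP k : nnmeas (Fr k) by exact: (nnmeas_comp (FP _) measurable_catr).
pose A (p : X * Y) := \prod_k Fl k (Defs.proj alpha k p.1, p.2) `^ w k.
pose r k (p : X * Y) := Fr k (p.1, Defs.proj alpha' k p.2).
have AP : nnmeas A.
  apply: nnmeas_prod => k; apply: nnmeas_poweR.
  have mg : measurable_fun setT
      (fun p : X * Y => (Defs.proj alpha k p.1, p.2) : m.-tuple mR * Y).
    apply: measurable_fun_pair; last exact: measurable_snd.
    exact: (measurableT_comp (measurable_proj alpha k) measurable_fst).
  exact: (nnmeas_comp (FlP k) mg).
have rP k : nnmeas (r k).
  have mg : measurable_fun setT
      (fun p : X * Y => (p.1, Defs.proj alpha' k p.2) : X * m'.-tuple mR).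
    apply: measurable_fun_pair; first exact: measurable_fst.
    exact: (measurableT_comp (measurable_proj alpha' k) measurable_snd).
  exact: (nnmeas_comp (FrP k) mg).
pose H p := A p `^ s * \prod_k r k p `^ (s' * w' k).
have HP : nnmeas H.
  apply: nnmeasM; first exact: nnmeas_poweR.
  by apply: nnmeas_prod => k; exact: nnmeas_poweR.
pose L k (y : Y) := \int[borel_lebesgue m]_z Fl k (z, y).
pose Q k (z : m'.-tuple mR) := \int[@carnot_lebesgue R m]_x Fr k (x, z).
have swapP d1 d2 (T1 : measurableType d1) (T2 : measurableType d2)
    (mu : {sigma_finite_measure set T1 -> \bar R}) (f : T1 * T2 -> \bar R) :
    nnmeas f -> nnmeas (fun y => \int[mu]_x f (x, y)).
  move=> [mf f0]; split; first exact: measurable_fun_fubini_tonelli_G.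
  by move=> y; apply: integral_ge0 => x _.
have LP k : nnmeas (L k) by exact: swapP.
have QP k : nnmeas (Q k) by exact: swapP.
pose B (y : Y) := \prod_k Q k (Defs.proj alpha' k y) `^ w' k.
have BP : nnmeas B.
  apply: nnmeas_prod => k; apply: nnmeas_poweR.
  exact: (nnmeas_comp (QP k) (measurable_proj alpha' k)).
have -> : \int[@carnot_lebesgue R m \x @carnot_lebesgue R m']_p
    (\prod_j F j (pibar alpha alpha' j p) `^ product_weight j) =
    \int[@carnot_lebesgue R m \x @carnot_lebesgue R m']_p H p.
  apply: eq_integral => p _; rewrite big_split_ord; congr (_ * _).
    rewrite /A poweR_prod; last by move=> k; exact: poweR_ge0.
    apply: eq_bigr => k _; rewrite pibar_l /product_weight (unsplitK (inl k)).
    by rewrite -poweRrM mulrC.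
  apply: eq_bigr => k _.
  by rewrite pibar_r /product_weight (unsplitK (inr k)).
rewrite (fubini_tonelli2 _ HP.1 HP.2).
apply: (@le_trans _ _ (\int[@carnot_lebesgue R m']_y
    (C1 `^ s * (B y `^ s' * \prod_k L k y `^ (s * w k))))).
  apply: le_integralT => y; first by apply: integral_ge0 => x _; exact: HP.2.
  have AyP := nnmeas_comp AP (measurable_pair2 y).
  have ryP k := nnmeas_comp (rP k) (measurable_pair2 y).
  apply: le_trans (hoelder_poweR_head (@carnot_lebesgue R m) (fun k => (ryP k).1)
    (fun k => (ryP k).2) sw'0 AyP.1 AyP.2 s0 sum1) _.
  have Abound := carnot_bound n0 alpha0 (fun k => nnmeas_comp (FlP k)
    (measurable_pair2 y)).
  have -> : \prod_k (\int[@carnot_lebesgue R m]_x (r k \o pair^~ y) x) `^ (s' * w' k) =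
      B y `^ s'.
    rewrite /B poweR_prod; last by move=> k; exact: poweR_ge0.
    by apply: eq_bigr => k _; rewrite -poweRrM mulrC.
  rewrite [leRHS]muleCA [leLHS]muleC; apply: lee_wpmul2l; first exact: poweR_ge0.
  have A0 : 0 <= \int[@carnot_lebesgue R m]_x (A \o pair^~ y) x.
    by apply: integral_ge0 => x _; exact: AP.2.
  apply: le_trans (ge0_le_poweR s0 A0 Abound) _.
  rewrite poweRM ?C10//; last by apply: prode_ge0 => k _; exact: poweR_ge0.
  rewrite poweR_prod; last by move=> k; exact: poweR_ge0.
  apply: eq_lee; congr (_ * _).
  by apply: eq_bigr => k _; rewrite -poweRrM mulrC.
rewrite nnmeas_integralZl ?poweR_ge0//; last first.
  apply: nnmeasM; first exact: nnmeas_poweR.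
  by apply: nnmeas_prod => k; exact: nnmeas_poweR.
rewrite -muleA; apply: lee_wpmul2l; first exact: poweR_ge0.
apply: le_trans (hoelder_poweR_head (@carnot_lebesgue R m') (fun k => (LP k).1)
  (fun k => (LP k).2) sw0 BP.1 BP.2 s'0 sum2) _.
rewrite [X in _ <= _ * X](@big_split_ord _ _ _ m m') [leRHS]muleA [leRHS]muleAC.
have -> : \prod_k (\int[@carnot_lebesgue R m']_y L k y) `^ (s * w k) =
    \prod_k (\int[borel_lebesgue (m + m').+1]_x F (lshift m' k) x)
      `^ product_weight (lshift m' k).
  apply: eq_bigr => k _; rewrite /product_weight (unsplitK (inl k)).
  by rewrite -(integral_catl (FP _)).
apply: lee_wpmul2r; first by apply: prode_ge0 => k _; exact: poweR_ge0.
have B0 : 0 <= \int[@carnot_lebesgue R m']_y B y.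
  by apply: integral_ge0 => y _; exact: BP.2.
apply: le_trans (ge0_le_poweR s'0 B0 (carnot_bound n'0 alpha'0 QP)) _.
rewrite poweRM ?C20//; last by apply: prode_ge0 => k _; exact: poweR_ge0.
rewrite poweR_prod; last by move=> k; exact: poweR_ge0.
apply: eq_lee; congr (_ * _).
apply: eq_bigr => k _; rewrite /product_weight (unsplitK (inr k)).
by rewrite -(integral_catr (FP _)) -poweRrM mulrC.
Qed.

End product_bound.

(** * The exponents of the theorem *)

Section exponents.
Context {R : realType}.

Definition lebesgue_exponent (d n d' n' j : nat) : R :=
  let m := (d + 2 * n)%N in let m' := (d' + 2 * n')%N in
  let N : R := (m + m' + 3)%:R in
  if (j < d)%N then N else if (j < m)%N then (n%:R * N / n.+1%:R)%R
  else if (j < m + d')%N then N else (n'%:R * N / n'.+1%:R)%R.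

Lemma prod_four (d n d' n' : nat) (x : 'I_(d + 2 * n + (d' + 2 * n')) -> \bar R) :
  let m := (d + 2 * n)%N in let m' := (d' + 2 * n')%N in
  \prod_(j < m + m') x j =
  (\prod_(j < m + m' | (j < d)%N) x j) *
  (\prod_(j < m + m' | (d <= j < m)%N) x j) *
  (\prod_(j < m + m' | (m <= j < m + d')%N) x j) *
  (\prod_(j < m + m' | (m + d' <= j)%N) x j).
Proof.
move=> m m'; rewrite (bigID (fun j : 'I__ => (j < m)%N))/= -!muleA [RHS]muleA.
congr (_ * _).
  rewrite (bigID (fun j : 'I__ => (j < d)%N))/=; congr (_ * _); apply: eq_bigl => j.
    by apply/andP/idP => [[]//|jd]; split => //; exact: leq_trans jd (leq_addr _ _).
  by rewrite -leqNgt andbC.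
rewrite (bigID (fun j : 'I__ => (j < m + d')%N))/=; congr (_ * _); apply: eq_bigl => j.
  by rewrite -leqNgt.
apply/andP/idP => [[_]|mj]; rewrite -?leqNgt//; split => //.
by rewrite (leq_trans (leq_addr _ _) mj).
Qed.

Lemma product_weightE d n d' n' (j : 'I_(d + 2 * n + (d' + 2 * n'))) :
  (0 < n)%N -> (0 < n')%N ->
  @product_weight R d n d' n' j = (lebesgue_exponent d n d' n' j)^-1%R.
Proof.
move=> n0 n'0.
have nr k : (0 < k)%N -> (k%:R != 0 :> R)%R by move=> k0; rewrite pnatr_eq0 -lt0n.
have := nr (d + 2 * n + (d' + 2 * n') + 3)%N; rewrite addn3 => /(_ isT) N0.
rewrite /product_weight /lebesgue_exponent /carnot_weight addn3.
case: (split_ordP j) => k ->.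
  rewrite /=; case: ifP => _.
    by rewrite mulrAC divff ?nr// mul1r.
  set N := (_ + _).+3%:R in N0 *.
  have a := nr _ n0; have b := nr _ (ltn0Sn n); have c := nr _ (ltn0Sn (d + 2 * n)).
  move: (d + 2 * n).+1%:R n.+1%:R n%:R N N0 a b c => /=.
  by move=> x y z w w0 z0 y0 x0; field; rewrite x0 y0 z0 w0.
rewrite /= (_ : (rshift (d + 2 * n) k < d)%N = false); last first.
  by rewrite ltnNge (leq_trans (leq_addr (2 * n) d)) ?leq_addr.
rewrite (_ : (rshift (d + 2 * n) k < d + 2 * n + d')%N = (k < d')%N); last first.
  by rewrite -[RHS](ltn_add2l (d + 2 * n)).
case: ifP => _.
  by rewrite mulrAC divff ?nr// mul1r.
set N := (_ + _).+3%:R in N0 *.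
have a := nr _ n'0; have b := nr _ (ltn0Sn n'); have c := nr _ (ltn0Sn (d' + 2 * n')).
move: (d' + 2 * n').+1%:R n'.+1%:R n'%:R N N0 a b c => /=.
by move=> x y z w w0 z0 y0 x0; field; rewrite x0 y0 z0 w0.
Qed.

Lemma lebesgue_exponent_gt0 d n d' n' j : (0 < n)%N -> (0 < n')%N ->
  (0 < lebesgue_exponent d n d' n' j)%R.
Proof.
move=> n0 n'0; rewrite /lebesgue_exponent addn3.
by do 3?case: ifP => _; rewrite ?ltr0n// !mulr_gt0 ?invr_gt0 ?ltr0n.
Qed.

End exponents.

Theorem theorem8 (R : realType) (d n d' n' : nat)
    (alpha : n.-tuple R) (alpha' : n'.-tuple R) :
  (0 < n)%N -> (0 < n')%N ->
  (forall i, 0 < tnth alpha i)%R ->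
  (forall i j : 'I_n, (i <= j)%N -> (tnth alpha i <= tnth alpha j)%R) ->
  (forall i, 0 < tnth alpha' i)%R ->
  (forall i j : 'I_n', (i <= j)%N -> (tnth alpha' i <= tnth alpha' j)%R) ->
  let m := (d + 2 * n)%N in
  let m' := (d' + 2 * n')%N in
  let N : R := (m + m' + 3)%:R in
  let lambda := @lebesgue_tuple R (m + m').+1 in
  let C : \bar R :=
    radon_norm (3 / 2 : R) 3 `^ (6 / N) *
    (((\prod_(i < n) tnth alpha i) `^ (n%:R * N)^-1 *
      (\prod_(i < n') tnth alpha' i) `^ (n'%:R * N)^-1)^-1)%R%:E in
  forall f : 'I_(m + m') -> (m + m').+1.-tuple R -> \bar R,
  (forall j, lebesgue_measurable_fun (f j)) ->
  (forall j x, 0 <= f j x) ->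
  \int[lebesgue_carnot2 m m']_p \prod_(j < m + m') f j (pibar alpha alpha' j p)
  <= C
     * (\prod_(j < m + m' | (j < d)%N) 'N[lambda]_(N%:E)[f j])
     * (\prod_(j < m + m' | (d <= j < m)%N)
          'N[lambda]_((n%:R * N / n.+1%:R)%R%:E)[f j])
     * (\prod_(j < m + m' | (m <= j < m + d')%N) 'N[lambda]_(N%:E)[f j])
     * (\prod_(j < m + m' | (m + d' <= j)%N)
          'N[lambda]_((n'%:R * N / n'.+1%:R)%R%:E)[f j]).
Proof.
move=> n0 n'0 alpha0 _ alpha'0 _ m m' N lambda C f mf f0.
pose p j := @lebesgue_exponent R d n d' n' j.
have p0 j : (0 < p j)%R by exact: lebesgue_exponent_gt0.
pose P (j : 'I_(m + m')) := 'N[lambda]_((p j)%:E)[f j].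
have -> : C
     * (\prod_(j < m + m' | (j < d)%N) 'N[lambda]_(N%:E)[f j])
     * (\prod_(j < m + m' | (d <= j < m)%N)
          'N[lambda]_((n%:R * N / n.+1%:R)%R%:E)[f j])
     * (\prod_(j < m + m' | (m <= j < m + d')%N) 'N[lambda]_(N%:E)[f j])
     * (\prod_(j < m + m' | (m + d' <= j)%N)
          'N[lambda]_((n'%:R * N / n'.+1%:R)%R%:E)[f j]) = C * \prod_j P j.
  rewrite [in RHS](prod_four P) !muleA.
  congr (_ * _ * _ * _ * _); apply: eq_bigr => j; rewrite /P /p /lebesgue_exponent.
  - by move=> ->.
  - by move=> /andP[dj jm]; rewrite ltnNge dj jm.
  - by move=> /andP[mj jmd]; rewrite !ltnNge (leq_trans (leq_addr (2 * n) d) mj) mj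
    /= -ltnNge jmd.
  - move=> mdj; rewrite !ltnNge mdj (leq_trans (leq_addr d' _) mdj).
    by rewrite (leq_trans (leq_trans (leq_addr (2 * n) d) (leq_addr d' _)) mdj).
have fP j : @nnmeas R _ (caratheodory_type (@borel_lebesgue R (m + m').+1)^*%mu) (f j).
  by split; [exact: mf|exact: f0].
have /choice[g gP] := fun j => borel_majorant (fP j).
pose G j x := g j x `^ p j.
have gnn j : nnmeas (g j) by have [] := gP j.
have GP j : nnmeas (G j) by exact: nnmeas_poweR.
have intG j : (\int[borel_lebesgue (m + m').+1]_x G j x) `^ (p j)^-1 = P j.
  rewrite /P unlock /Lnorm; congr (_ `^ _).
  rewrite -(integral_completed _ (GP j)).
  have mG := (nnmeas_comp (GP j)
    (@measurable_completed_id _ _ R (@borel_lebesgue R (m + m').+1))).1.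
  have mF := measurable_fun_poweR (p j)
    (measurableT_comp (@abse_measurable R setT) (mf j)).
  apply: (ge0_ae_eq_integral measurableT mG mF).
  - by move=> x _; exact: (GP j).2.
  - by move=> x _; exact: poweR_ge0.
  - have [_ _ [A [mA A0 sA]]] := gP j; exists A; split => // x nx; apply: sA.
    by apply: contra_not nx => gx _; rewrite /= /G gx gee0_abs.
apply: (@le_trans _ _ (\int[lebesgue_carnot2 m m']_q
    \prod_j G j (pibar alpha alpha' j q) `^ @product_weight R d n d' n' j)).
  apply: le_integralT => q; first by apply: prode_ge0.
  apply: ge0_le_prod => // j.
  rewrite product_weightE// /G poweRVK ?gt_eqF//; first by have [] := gP j.
  exact: (gnn j).2.
have HP : nnmeas (fun q : (m.-tuple (measurableTypeR R) * measurableTypeR R) *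
    (m'.-tuple (measurableTypeR R) * measurableTypeR R) =>
    \prod_j G j (pibar alpha alpha' j q) `^ @product_weight R d n d' n' j).
  apply: nnmeas_prod => j; apply: nnmeas_poweR.
  exact: (nnmeas_comp (GP j) (measurable_pibar alpha alpha' j)).
rewrite [leLHS](integral_completed
  (@carnot_lebesgue R m \x @carnot_lebesgue R m') HP).
apply: le_trans (product_bound n0 n'0 alpha0 alpha'0 GP) _.
apply: eq_lee; congr (_ * _); last first.
  by apply: eq_bigr => j _; rewrite product_weightE.
have rn : (n%:R != 0 :> R)%R by rewrite pnatr_eq0 -lt0n.
have rn' : (n'%:R != 0 :> R)%R by rewrite pnatr_eq0 -lt0n.
have N0 : (0 < N)%R by rewrite /N ltr0n addn3.
have Gam := @radonN_ge0 R.
have K (k e : nat) (b : k.-tuple R) : (0 < k)%N -> (forall i, 0 < tnth b i)%R ->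
    (radon_norm (3 / 2 : R) 3 `^ (3 / e.+1%:R) *
      ((\prod_i tnth b i) `^ (- (k%:R * e.+1%:R)^-1))%:E) `^ (e.+1%:R / N) =
    radon_norm (3 / 2 : R) 3 `^ (3 / N) *
      (((\prod_i tnth b i) `^ (k%:R * N)^-1)^-1)%R%:E.
  move=> k0 b0; have rk : (k%:R != 0 :> R)%R by rewrite pnatr_eq0 -lt0n.
  have re : (e.+1%:R != 0 :> R)%R by rewrite pnatr_eq0.
  rewrite poweRM ?poweR_ge0 ?lee_fin ?powR_ge0// -poweRrM poweR_EFin -powRrM -powRN.
  move: e.+1%:R re => x x0.
  by congr (_ `^ _ * (_ `^ _)%:E); field; rewrite ?x0 ?rk gt_eqF.
rewrite !K// muleACA -ge0_poweRD ?divr_ge0 ?(ltW N0)// -EFinM -invfM.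
by congr (_ `^ _ * _); field; rewrite gt_eqF.
Qed.
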